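(* Let $E$ be a real Banach space of dimension at least $2$, let $D\subsetneq E$ be a domain, let $P\subset D$ be a countable closed subset of $D$ such that $k_D(x,y)\ge \frac12$ for all distinct $x,y\in P$, and let $G=D\setminus P$. Then $D$ is a $\psi$-uniform domain if and only if $G$ is a $\psi_1$-uniform domain, quantitatively in the following sense. (i) If $\psi:[0,\infty)\to[0,\infty)$ is a homeomorphism and $D$ is $\psi$-uniform, then $G$ is $\psi_1$-uniform with $\psi_1(t)=2^{12}\psi(t)$ for $t\ge 0$. (ii) If $\psi_1:[0,\infty)\to[0,\infty)$ is a homeomorphism and $G$ is $\psi_1$-uniform, then $D$ is $\psi$-uniform with $\psi(t)=3\psi_1(2^7t)$ for $t\ge 0$.
   Context: The norm of $z\in E$ is written $|z|$. A domain is a nonempty open connected set. For a domain $U\subsetneq E$, $d_U(z)$ denotes the distance from $z$ to the boundary $\partial U$ of $U$. The quasihyperbolic length of a rectifiable arc $\alpha$ in $U$ is $\ell_{k_U}(\alpha)=\int_\alpha \frac{|dz|}{d_U(z)}$, and the quasihyperbolic distance is $k_U(z_1,z_2)=\inf_\alpha \ell_{k_U}(\alpha)$, the infimum being over all rectifiable arcs $\alpha$ in $U$ joining $z_1$ and $z_2$. For a homeomorphism $\psi:[0,\infty)\to[0,\infty)$, $U$ is called $\psi$-uniform if $k_U(z_1,z_2)\le \psi\big(\frac{|z_1-z_2|}{\min\{d_U(z_1),d_U(z_2)\}}\big)$ for all $z_1,z_2\in U$. Countable means finite or countably infinite, and closed means relatively closed in $D$. *)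

(* Defs.v *)
From HB Require Import structures.
From mathcomp Require Import all_boot all_order all_algebra.
From mathcomp Require Import all_classical all_reals all_analysis.

Set Implicit Arguments.
Unset Strict Implicit.
Unset Printing Implicit Defensive.

Import Order.TTheory GRing.Theory Num.Theory.
Import numFieldNormedType.Exports.

Local Open Scope classical_set_scope.
Local Open Scope ring_scope.

Section QuasihyperbolicMetric.
Context {R : realType} {E : normedModType R}.
Implicit Types (U : set E) (z w : E) (gamma : R -> E) (psi : R -> R).

Definition dim_ge2 (V : lmodType R) : Prop :=
  exists u v : V, forall a b : R, a *: u + b *: v = 0 -> a = 0 /\ b = 0.

Definition domain U : Prop := [/\ open U, U !=set0 & connected U].

Definition boundary U : set E := closure U `\` interior U.

(** Only meaningful when the boundary of [U] is nonempty, which holds for every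
    domain [U] different from the whole space. *)
Definition bdist U z : R := inf [set `|z - w| | w in boundary U].

(** The analogue of [variation], for functions with values in [E]. *)
Definition polygon_length gamma (a b : R) (s : seq R) : R :=
  let F := gamma \o nth b (a :: s) in
  \sum_(0 <= n < size s) `|F n.+1 - F n|.

Definition curve_length gamma (a b : R) : \bar R :=
  ereal_sup [set (polygon_length gamma a b s)%:E | s in itv_partition a b].

(** An arc is an injective continuous image of a compact interval; the case
    [a = b] is the one-point arc, which joins a point to itself. *)
Definition rectifiable_arc U z1 z2 (a b : R) gamma : Prop :=
  [/\ a <= b,
      {within `[a, b], continuous gamma} /\ {in `[a, b] &, injective gamma},
      gamma @` `[a, b] `<=` U,
      gamma a = z1 /\ gamma b = z2 &
      (curve_length gamma a b < +oo)%E].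

(** The arc-length parametrization of the arc [gamma] on [`[a, b]]: for [s]
    between 0 and the length of the arc, it is the point [gamma t] for the
    first [t] such that [gamma] has length [s] on [`[a, t]]. *)
Definition arc_length_param gamma (a b s : R) : E :=
  gamma (inf [set t | t \in `[a, b] /\ (s%:E <= curve_length gamma a t)%E]).

(** The integral of [1 / bdist U] with respect to arc length. *)
Definition qh_length U (a b : R) gamma : \bar R :=
  (\int[@lebesgue_measure R]_(s in `[0%R, fine (curve_length gamma a b)])
     ((bdist U (arc_length_param gamma a b s))^-1)%:E)%E.

Definition qh_dist U z1 z2 : \bar R :=
  ereal_inf [set l | exists (a b : R) gamma,
    rectifiable_arc U z1 z2 a b gamma /\ l = qh_length U a b gamma].

(** [psi] restricts to a homeomorphism of [0, +oo[ onto itself; its values at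
    negative arguments are irrelevant. *)
Definition half_line_homeo psi : Prop :=
  [/\ set_bij `[0, +oo[ `[0, +oo[ psi,
      {within `[0, +oo[, continuous psi} &
      exists2 phi : R -> R, {in `[0, +oo[, cancel psi phi} &
                            {within `[0, +oo[, continuous phi}].

Definition uniform_domain psi U : Prop :=
  [/\ half_line_homeo psi, domain U, U <> setT &
      forall z1 z2, U z1 -> U z2 ->
        (qh_dist U z1 z2 <=
         (psi (`|z1 - z2| / Num.min (bdist U z1) (bdist U z2)))%:E)%E].

End QuasihyperbolicMetric.

(* Main.v *)
Require Import Defs.
From HB Require Import structures.
From mathcomp Require Import all_boot all_order all_algebra.
From mathcomp Require Import all_classical all_reals all_analysis.
From mathcomp Require Import measurable_realfun ring lra.
Set Implicit Arguments.
Unset Strict Implicit.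
Unset Printing Implicit Defensive.
Import Order.TTheory GRing.Theory Num.Theory.
Import numFieldNormedType.Exports.
Local Open Scope classical_set_scope.
Local Open Scope ring_scope.

(** Quasihyperbolic distances can be estimated on chains of points instead of
    arcs. An arc, parametrized by arc length, is a [1]-Lipschitz path, and
    sampling it finely gives a chain whose steps are short compared with the distance to the boundary and whose total cost is
    at most the quasihyperbolic length of the arc, up to a factor arbitrarily
    close to [1] ([qh_dist_chain]). Conversely the polygon through a chain can
    be pruned to an injective arc without increasing its length
    ([chain_qh_dist]). This yields the triangle inequality and the lower bound
    [ln (1 + `|y - x| / bdist U x)] for [qh_dist U x y]; a segment at distance
    at least [m] from the boundary gives the upper bound [`|z - y| / m].

    Two observations then reduce the theorem to geometry. First, the control
    function of a uniform domain is at least [ln (1 + t)] at every [t >= 0]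
    ([uniform_domain_ln]), so that logarithmic costs may be absorbed in it.
    Second, distinct points [x, y] of [P] satisfy [`|x - y| >= bdist D x / 3]
    ([separated_norm]); therefore [G] contains the punctured ball of radius
    [bdist D x / 6] around each [x] in [P], and there the distance to the
    boundary of [G] is the distance to [x] ([punctured_ball]). In dimension at
    least [2] the puncture can be avoided: moving radially costs the logarithm
    of the ratio of the radii, and moving around a sphere costs a constant
    ([punctured_ball_qh_dist]).

    From [D] to [G]: if [u] and [v] are close on the scale of [bdist D u], the
    detour gives [50 * ln (1 + t)], where [t] is the ratio in the definition of
    uniformity of [G] ([qh_dist_G_local_ln]). Otherwise both are first moved to
    points that keep away from [P] on the scale of [D]. A chain in [D] between
    them, of cost slightly above [psi t], is cut into blocks of bounded
    quasihyperbolic size, and successive points of this kind next to the ends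
    of the blocks are joined in [G] at bounded cost; the number of complete
    blocks is at most proportional to the cost of the chain ([chain_D_good],
    [qh_dist_G_good]). The remaining terms are constants and logarithms; they
    are at most multiples of [psi t], because [t] is bounded below
    ([qh_dist_G_le]).

    From [G] to [D]: the quasihyperbolic distance of [D] is at most that of
    [G]. Moving two points of [D] away from [P] is cheap in [D] and, when they
    are far apart, multiplies the ratio by at most [2 ^+ 7]; when they are
    close, a segment joins them ([qh_dist_D_le]).

    The bounds on [G] also show that any two of its points are joined by an
    arc, whence [G] is connected. *)

(** * Length of curves *)

Section ArcLength.
Context {R : realType} {E : normedModType R}.
Implicit Types (g : R -> E) (a b t : R) (s : seq R).

Lemma polygon_length_rcons g a b s c : last a s = b ->
  polygon_length g a c (rcons s c) = polygon_length g a b s + `|g c - g b|.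
Proof.
move=> lsb; rewrite /polygon_length size_rcons big_nat_recr //=; congr (_ + _).
  rewrite big_nat_cond [RHS]big_nat_cond; apply: eq_bigr => i /andP[/andP[_ ilt] _].
  rewrite -[a :: rcons s c]/(rcons (a :: s) c) -[rcons s c]/(behead (rcons (a :: s) c)).
  rewrite nth_behead !nth_rcons /= ltnS ilt ltnW ?ltnS //.
  congr (`|g _ - g _|); apply: set_nth_default; rewrite /= ?ltnS //.
  exact: ltnW.
congr (`|g _ - g _|); first by rewrite nth_rcons ltnn eqxx.
rewrite -[a :: rcons s c]/(rcons (a :: s) c) nth_rcons /= ltnS leqnn -lsb.
by rewrite (last_nth c).
Qed.

Lemma itv_partition_rcons a b c s :
  itv_partition a b s -> b < c -> itv_partition a c (rcons s c).
Proof.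
move=> [p /eqP l] bc; split; last by rewrite last_rcons.
by rewrite rcons_path p l.
Qed.

Lemma itv_partitionP a b (s : seq R) : itv_partition a b s ->
  s = [::] /\ a = b \/
  exists s' c, [/\ s = rcons s' b, itv_partition a c s' & c < b].
Proof.
case: (lastP s) => [/itv_partition_nil ->|s' x [p /eqP]]; first by left.
rewrite last_rcons => xb; right; exists s', (last a s').
by move: p; rewrite rcons_path xb => /andP[p l].
Qed.

Lemma polygon_length_le (V : R -> R) g a b s : itv_partition a b s ->
  (forall t t', a <= t -> t <= t' -> t' <= b -> `|g t' - g t| <= V t' - V t) ->
  polygon_length g a b s <= V b - V a.
Proof.
elim/last_ind: s b => [|s x IH] b.
  by move=> /itv_partition_nil -> _; rewrite /polygon_length big_nil subrr.
move=> sP dom; case: (itv_partitionP sP) => [[]|]; first by case: (s).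
move=> [s' [c [/rcons_inj[<- ->] s'P cb]]].
rewrite (@polygon_length_rcons _ _ c); last by case: s'P => _ /eqP.
have ac := itv_partition_le s'P.
have := dom c b ac (ltW cb) (lexx _).
have := IH _ s'P (fun t t' at' tt' t'c => dom t t' at' tt' (le_trans t'c (ltW cb))).
lra.
Qed.

Lemma curve_length_le (V : R -> R) g a b :
  (forall t t', a <= t -> t <= t' -> t' <= b -> `|g t' - g t| <= V t' - V t) ->
  (curve_length g a b <= (V b - V a)%:E)%E.
Proof.
move=> dom; apply: ge_ereal_sup => _ [s sP <-].
by rewrite lee_fin; exact: polygon_length_le.
Qed.

(** A partition can be prolonged by one more vertex. This form of additivity
    makes the arc-length parametrization [1]-Lipschitz. *)
Lemma curve_lengthD_chord g a t t' : a <= t -> t <= t' ->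
  (curve_length g a t + `|g t' - g t|%:E <= curve_length g a t')%E.
Proof.
move=> a_t; rewrite le_eqVlt => /predU1P[<-|tt'].
  by rewrite subrr normr0 adde0.
rewrite -leeBrDr //; apply: ge_ereal_sup => _ [s sP <-].
rewrite leeBrDr // -EFinD; apply: ereal_sup_ubound.
exists (rcons s t'); first exact: itv_partition_rcons tt'.
by rewrite (@polygon_length_rcons _ _ t) //; case: sP => _ /eqP.
Qed.

Lemma curve_length_ge0 g a b : a <= b -> (0 <= curve_length g a b)%E.
Proof.
move=> ab; have : (curve_length g a a <= curve_length g a b)%E.
  apply: le_trans (curve_lengthD_chord g (lexx a) ab).
  by rewrite leeDl // lee_fin.
apply: le_trans; apply: ereal_sup_ubound; exists [::]; first by split => //=.
by rewrite /polygon_length big_nil.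
Qed.

Lemma le_curve_length g a t t' : a <= t -> t <= t' ->
  (curve_length g a t <= curve_length g a t')%E.
Proof.
move=> a_t tt'; apply: le_trans (curve_lengthD_chord g a_t tt').
by rewrite leeDl // lee_fin.
Qed.

Lemma eq_curve_length g g' a b : (forall t, a <= t -> t <= b -> g t = g' t) ->
  a <= b -> curve_length g a b = curve_length g' a b.
Proof.
move=> gg' ab; rewrite /curve_length; congr ereal_sup.
apply: eq_imagel => s sP; congr (_%:E); apply: eq_big_nat => i /andP[_ ilt].
have nth_in k : (k < (size s).+1)%N -> g (nth b (a :: s) k) = g' (nth b (a :: s) k).
  by move=> ks; apply: gg'; [exact: itv_partition_nth_ge sP|exact: itv_partition_nth_le sP].
by rewrite [LHS]/= [RHS]/= !(nth_in i.+1, nth_in i) ?ltnS ?(ltnW ilt).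
Qed.

End ArcLength.

(** * The arc-length parametrization is 1-Lipschitz *)

Section ArcLengthParam.
Context {R : realType} {E : normedModType R}.
Implicit Types (U : set E) (z : E) (g : R -> E).

Lemma within_continuous_eps g (a b c e : R) : {within `[a, b], continuous g} ->
  a <= c <= b -> 0 < e -> exists2 r, 0 < r &
    forall t, a <= t <= b -> `|t - c| < r -> `|g t - g c| < e.
Proof.
move=> /subspace_continuousP gc acb e0.
have := gc c; rewrite /= in_itv /= => /(_ acb) /cvgrPdist_lt /(_ e e0).
rewrite /prop_near1 /within /= => /nbhs_ballP[r /= r0 H].
exists r => // t atb tc; rewrite distrC; apply: H.
  by rewrite /ball /= distrC.
by rewrite /= in_itv.
Qed.

Context (U : set E) (z1 z2 : E) (a b : R) (g : R -> E).
Hypothesis arc_g : rectifiable_arc U z1 z2 a b g.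
Let L := fine (curve_length g a b).
Let A s := [set t | t \in `[a, b] /\ (s%:E <= curve_length g a t)%E].
Let tau s := inf (A s).

Let ab : a <= b. Proof. by case: arc_g. Qed.

Let lenE : curve_length g a b = L%:E.
Proof.
rewrite fineK // ge0_fin_numE ?curve_length_ge0 //.
by case: arc_g.
Qed.

Let A_b s : s <= L -> A s b.
Proof. by move=> sL; split; rewrite ?in_itv /= ?ab ?lexx // lenE lee_fin. Qed.

Let A_inf s : s <= L -> has_inf (A s).
Proof.
move=> sL; split; first by exists b; exact: A_b.
by exists a => t [] /=; rewrite in_itv /= => /andP[].
Qed.

Let tau_itv s : s <= L -> a <= tau s <= b.
Proof.
move=> sL; apply/andP; split.
  apply: lb_le_inf; first by case: (A_inf sL).
  by move=> t [] /=; rewrite in_itv /= => /andP[].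
by apply: ge_inf; [case: (A_inf sL)|exact: A_b].
Qed.

Let lt_tau s t : s <= L -> a <= t -> t < tau s -> (curve_length g a t < s%:E)%E.
Proof.
move=> sL a_t tlt; rewrite ltNge; apply/negP => le_s.
have : tau s <= t.
  apply: ge_inf; first by case: (A_inf sL).
  split=> //; rewrite in_itv /= a_t /=.
  by case/andP: (tau_itv sL) => _; apply: le_trans; exact: ltW.
by rewrite leNgt tlt.
Qed.

Let gt_tau s t : s <= L -> tau s < t -> (s%:E <= curve_length g a t)%E.
Proof.
move=> sL tlt; have [u [+ su] ut] := inf_lt (A_inf sL).1 tlt.
rewrite in_itv /= => /andP[au ub].
exact/(le_trans su)/le_curve_length/ltW.
Qed.

Let le_tau s s' : s <= s' -> s' <= L -> tau s <= tau s'.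
Proof.
move=> ss' s'L; apply: lb_le_inf; first by case: (A_inf s'L).
move=> t [tab s't]; apply: ge_inf; first by case: (A_inf (le_trans ss' s'L)).
by split=> //; apply: le_trans s't; rewrite lee_fin.
Qed.

Lemma arc_length_param_lipschitz s s' : s <= s' -> s' <= L ->
  `|arc_length_param g a b s' - arc_length_param g a b s| <= s' - s.
Proof.
move=> ss' s'L; rewrite /arc_length_param -/(A s) -/(A s') -/(tau s) -/(tau s').
have sL := le_trans ss' s'L.
have [c1 c2] := (tau_itv sL, tau_itv s'L).
move: (le_tau ss' s'L); rewrite le_eqVlt => /predU1P[->|lt_tt].
  by rewrite subrr normr0 subr_ge0.
have gc : {within `[a, b], continuous g} by case: arc_g => _ [].
apply/ler_addgt0Pr => e e0.
have e20 : 0 < e / 2 by rewrite divr_gt0.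
have [r r0 Hr] := within_continuous_eps gc c1 e20.
have [r' r'0 Hr'] := within_continuous_eps gc c2 e20.
pose m := (tau s + tau s') / 2.
(* points strictly between the two parameters, close to each of them *)
pose t := Num.min m (tau s + r / 2); pose t' := Num.max m (tau s' - r' / 2).
have t_b : tau s < t /\ t <= m /\ t <= tau s + r / 2.
  by rewrite /t lt_min !ge_min !lexx orbT /= /m; split; [apply/andP; split|]; lra.
have t'_b : t' < tau s' /\ m <= t' /\ tau s' - r' / 2 <= t'.
  by rewrite /t' gt_max !le_max !lexx orbT /= /m; split; [apply/andP; split|]; lra.
case: t_b t'_b => [t1 [t2 t3]] [t'1 [t'2 t'3]].
have dt : `|g t - g (tau s)| < e / 2.
  by apply: Hr; [apply/andP; split|rewrite ltr_norml; apply/andP; split]; lra.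
have dt' : `|g t' - g (tau s')| < e / 2.
  by apply: Hr'; [apply/andP; split|rewrite ltr_norml; apply/andP; split]; lra.
have chord : `|g t' - g t| <= s' - s.
  have at' : a <= t by lra.
  have tt' : t <= t' by lra.
  have := curve_lengthD_chord g at' tt'.
  have := gt_tau sL t1; have := lt_tau s'L (le_trans at' tt') t'1.
  have := curve_length_ge0 g at'; have := curve_length_ge0 g (le_trans at' tt').
  case: (curve_length g a t) => [x| |] //; case: (curve_length g a t') => [y| |] //=.
  rewrite !lee_fin lte_fin; lra.
rewrite distrC in dt'.
have -> : g (tau s') - g (tau s)
   = (g (tau s') - g t') + (g t' - g t) + (g t - g (tau s)).
  by rewrite !addrA !subrK.
apply: le_trans (ler_normD _ _) _.
have := ler_normD (g (tau s') - g t') (g t' - g t); lra.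
Qed.

Lemma arc_length_param0 : arc_length_param g a b 0 = z1.
Proof.
have L0 : 0 <= L by rewrite fine_ge0 // curve_length_ge0.
have [_ _ _ [<- _] _] := arc_g; rewrite /arc_length_param -/(A 0) -/(tau 0); congr g.
apply/le_anti/andP; split; last by case/andP: (tau_itv L0).
apply: ge_inf; first by case: (A_inf L0).
by split; rewrite ?in_itv /= ?lexx ?ab ?curve_length_ge0.
Qed.

Lemma arc_length_param_end : arc_length_param g a b L = z2.
Proof.
have [_ [_ inj] _ [_ <-] _] := arc_g; rewrite /arc_length_param -/(A L) -/(tau L).
congr g; have /andP[t1 t2] := tau_itv (lexx L).
apply/eqP; rewrite eq_le t2 leNgt; apply/negP => lt.
(* beyond the first parameter of full length the arc would be constant *)
pose t := (tau L + b) / 2.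
have [t3 t4] : tau L < t /\ t < b by rewrite /t; lra.
have tb := ltW t4.
have a_t : a <= t by lra.
have : g t = g b.
  apply/esym/eqP; rewrite -subr_eq0 -normr_le0.
  have := curve_lengthD_chord g a_t tb; have := gt_tau (lexx L) t3.
  rewrite lenE; have := curve_length_ge0 g a_t.
  by case: (curve_length g a t) => [x| |] //; rewrite !lee_fin; lra.
by move=> /inj; rewrite !in_itv /= a_t tb ab lexx => /(_ isT isT); lra.
Qed.

Lemma arc_length_param_in s : s <= L -> U (arc_length_param g a b s).
Proof.
move=> sL; have [_ _ sub _ _] := arc_g; apply: sub.
by exists (tau s) => //=; rewrite in_itv /= tau_itv.
Qed.

Lemma arc_length_ge0 : 0 <= L.
Proof. by rewrite fine_ge0 // curve_length_ge0. Qed.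

End ArcLengthParam.

(** * Distance to the boundary *)

Section BoundaryDistance.
Context {R : realType} {E : normedModType R}.
Implicit Types (U : set E) (x y z w : E).

Lemma lipschitz1_continuous (V : normedModType R) (W : normedModType R) (f : V -> W) :
  (forall a b, `|f a - f b| <= `|a - b|) -> continuous f.
Proof.
move=> lip a; apply/cvgrPdist_lt => e e0.
near=> b; apply: le_lt_trans (lip _ _) _.
near: b; apply/nbhs_ballP; exists e => //= b; by rewrite -ball_normE.
Unshelve. all: by end_near. Qed.

Let has_lb U z : has_lbound [set `|z - w| | w in boundary U].
Proof. by exists 0 => _ [w _ <-]. Qed.

Lemma bdist_ge0 U z : 0 <= bdist U z.
Proof.
rewrite /bdist; case: (pselect ([set `|z - w| | w in boundary U] !=set0)) => ne.
  by apply: lb_le_inf => // _ [w _ <-].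
by rewrite inf_out // => -[].
Qed.

Lemma bdist_le U z b : boundary U b -> bdist U z <= `|z - b|.
Proof. by move=> bU; apply: ge_inf; [exact: has_lb|exists b]. Qed.

Lemma bdist_lipschitz U x y : bdist U x <= bdist U y + `|x - y|.
Proof.
(* with an empty boundary both sides involve the infimum of the empty set *)
case: (pselect (boundary U !=set0)) => [[b bU]|/set0P/negP/negPn/eqP U0]; last first.
  by rewrite /bdist U0 !image_set0 lerDl.
rewrite -lerBlDr; apply: lb_le_inf; first by exists `|y - b|; exists b.
move=> _ [c cU <-]; rewrite lerBlDr; apply: le_trans (bdist_le x cU) _.
by have := ler_normD (x - y) (y - c); rewrite addrA subrK [leRHS]addrC.
Qed.

Lemma bdist_continuous U : continuous (bdist U : E -> R).
Proof.
apply: lipschitz1_continuous => x y; rewrite ler_norml; apply/andP; split.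
  by have := bdist_lipschitz U y x; rewrite distrC; lra.
by have := bdist_lipschitz U x y; lra.
Qed.

(** A segment that leaves an open set does so through the boundary. This turns
    the distance to the boundary into the distance to the complement, the form
    in which it is used below ([ball_bdist], [bdist_ge]). *)
Lemma first_exit U z w : open U -> U z -> ~ U w ->
  exists b, [/\ boundary U b, `|z - b| <= `|z - w| &
    forall s : R, 0 <= s -> s < 1 -> U (z + s *: (b - z))].
Proof.
move=> oU Uz nUw.
pose S := [set t : R | 0 <= t /\ ~ U (z + t *: (w - z))].
have S1 : S 1 by split=> //; rewrite scale1r addrC subrK.
have lbS : has_lbound S by exists 0 => t [].
have iS : has_inf S by split=> //; exists 1.
pose q := inf S.
have q0 : 0 <= q by apply: lb_le_inf; [exists 1|move=> t []].
have q1 : q <= 1 by apply: ge_inf.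
have below t : 0 <= t -> t < q -> U (z + t *: (w - z)).
  move=> t0 tq; apply: contrapT => nU.
  suff : q <= t by rewrite leNgt tq.
  exact: ge_inf.
pose c := z + q *: (w - z).
have wz0 : 0 < `|w - z|.
  by rewrite normr_gt0 subr_eq0; apply/eqP => wz; apply: nUw; rewrite wz.
have ray_dist t t' :
    `|z + t *: (w - z) - (z + t' *: (w - z))| = `|t - t'| * `|w - z|.
  by rewrite opprD addrACA subrr add0r -scalerBl normrZ.
have nUc : ~ U c.
  move=> Uc; have := open_nbhs_nbhs (conj oU Uc) => /nbhs_ballP[e /= e0 He].
  have qe : q < q + e / `|w - z| by rewrite ltrDl divr_gt0.
  have [t [t0 nUt] tlt] := inf_lt iS.1 qe.
  have qt : q <= t by apply: ge_inf.
  apply: nUt; apply: He; rewrite -ball_normE /= /c.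
  rewrite ray_dist distrC ger0_norm ?subr_ge0 //.
  by rewrite -ltr_pdivlMr // ltrBlDl.
exists c; split.
- split; last by move=> /interior_subset.
  move=> B /nbhs_ballP[e /= e0 He].
  have q_gt0 : 0 < q.
    rewrite lt_neqAle q0 andbT; apply/eqP => q_eq.
    by apply: nUc; rewrite /c -q_eq scale0r addr0.
  pose r := e / `|w - z|.
  have r0 : 0 < r by rewrite divr_gt0.
  pose t := Num.max 0 (q - r / 2).
  have [t0 tq tr] : [/\ 0 <= t, t < q & q - t < r].
    rewrite /t le_max lexx gt_max q_gt0 /=; split=> //; first by lra.
    by rewrite ltrBlDr -ltrBlDl lt_max; apply/orP; right; lra.
  exists (z + t *: (w - z)); split; first exact: below.
  apply: He; rewrite -ball_normE /= /c.
  by rewrite ray_dist ger0_norm ?subr_ge0 ?(ltW tq) // -ltr_pdivlMr.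
- rewrite /c opprD addrA subrr add0r normrN normrZ distrC ger0_norm //.
  by rewrite ler_piMl.
- move=> s s0 s1; rewrite /c (addrC z (q *: _)) addrK scalerA.
  case: (eqVneq q 0) => [->|q_neq0]; first by rewrite mulr0 scale0r addr0.
  apply: below; first exact: mulr_ge0.
  by rewrite gtr_pMl // lt_neqAle eq_sym q_neq0.
Qed.

Lemma ball_bdist U z w : open U -> U z -> `|z - w| < bdist U z -> U w.
Proof.
move=> oU Uz zw; apply: contrapT => nUw.
have [b [bU zb _]] := first_exit oU Uz nUw.
by have := bdist_le z bU; lra.
Qed.

Lemma bdist_ge U z r : open U -> U <> setT -> U z ->
  (forall w, `|z - w| < r -> U w) -> r <= bdist U z.
Proof.
move=> oU UT Uz zr.
have [w nUw] : exists w, ~ U w.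
  apply: contrapT => /forallNP H; apply: UT; apply/seteqP; split=> // w _.
  exact: contrapT (H w).
have [b [bU _ _]] := first_exit oU Uz nUw.
apply: lb_le_inf; first by exists `|z - b|; exists b.
move=> _ [c [_ nc] <-]; rewrite leNgt; apply/negP => /zr Uc.
by apply: nc; exact: open_nbhs_nbhs.
Qed.

Lemma bdist_gt0 U z : open U -> U <> setT -> U z -> 0 < bdist U z.
Proof.
move=> oU UT Uz; have := open_nbhs_nbhs (conj oU Uz) => /nbhs_ballP[e /= e0 He].
apply: lt_le_trans e0 _; apply: bdist_ge => // w zw.
by apply: He; rewrite -ball_normE.
Qed.

End BoundaryDistance.

(** * Unit-speed arcs and the cost of Lipschitz paths *)

Section UnitSpeed.
Context {R : realType} {E : normedModType R}.
Implicit Types (U : set E) (x y z : E) (d : R -> E) (L : R).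

Local Notation mu := (@lebesgue_measure R).

Lemma ge0_integral_itv_cat (f : R -> \bar R) (a b c : R) : a <= b -> b <= c ->
  measurable_fun `[a, c] f -> (forall s, a <= s <= c -> (0 <= f s)%E) ->
  (\int[mu]_(s in `[a, c]) f s =
   \int[mu]_(s in `[a, b]) f s + \int[mu]_(s in `]b, c]) f s)%E.
Proof.
move=> ab bc mf f0.
have acE : `[a, c]%classic = `[a, b] `|` `]b, c].
  by apply: itv_bndbnd_setU; rewrite bnd_simp.
rewrite acE ge0_integral_setU //; first by rewrite -acE.
  by move=> s; rewrite -acE /= in_itv /=; exact: f0.
apply/disj_setPS => s [/=]; rewrite !in_itv /= => /andP[_ sb] /andP[bs _].
by move: sb; rewrite leNgt bs.
Qed.

Lemma lebesgue_measure_itvoc (a b : R) : a <= b ->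
  mu `]a, b] = (b - a)%:E.
Proof.
move=> ab; rewrite lebesgue_measure_itv /= lte_fin.
case: ltgtP ab => // -> _; by rewrite subrr.
Qed.

Lemma integral_itvoc_le (f : R -> \bar R) (a b k : R) : a <= b ->
  measurable_fun `]a, b] f -> (forall s, a < s <= b -> (0 <= f s <= k%:E)%E) ->
  (\int[mu]_(s in `]a, b]) f s <= (k * (b - a))%:E)%E.
Proof.
move=> ab mf fk; rewrite EFinM -lebesgue_measure_itvoc //.
rewrite -(@integral_cst _ _ _ mu) //; apply: ge0_le_integral => //.
- by move=> s /=; rewrite in_itv /= => /fk /andP[].
- by move=> s /=; rewrite in_itv /= => /fk /andP[].
Qed.

Lemma integral_itvoc_ge (f : R -> \bar R) (a b k : R) : a <= b -> 0 <= k ->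
  measurable_fun `]a, b] f -> (forall s, a < s <= b -> (k%:E <= f s)%E) ->
  ((k * (b - a))%:E <= \int[mu]_(s in `]a, b]) f s)%E.
Proof.
move=> ab k0 mf fk; rewrite EFinM -lebesgue_measure_itvoc //.
by rewrite -(@integral_cst _ _ _ mu) //; apply: ge0_le_integral.
Qed.

Definition lipschitz_path U x y L d : Prop :=
  [/\ 0 <= L, d 0 = x, d L = y, forall s, 0 <= s -> s <= L -> U (d s) &
      forall s t, 0 <= s -> s <= t -> t <= L -> `|d t - d s| <= t - s].

Definition path_cost U L d : \bar R :=
  (\int[mu]_(s in `[0%R, L]) ((bdist U (d s))^-1)%:E)%E.

(** Such an arc is its own arc-length parametrization, so that its
    quasihyperbolic length is an integral along the path itself. *)
Definition unit_speed_arc U x y L d : Prop :=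
  [/\ lipschitz_path U x y L d,
      forall s t, 0 <= s -> s < t -> t <= L -> d s <> d t &
      forall t, 0 <= t -> t <= L -> curve_length d 0 t = t%:E].

Lemma rectifiable_arc_lipschitz U x y a b g : rectifiable_arc U x y a b g ->
  lipschitz_path U x y (fine (curve_length g a b)) (arc_length_param g a b).
Proof.
move=> arc; split.
- exact: arc_length_ge0 arc.
- exact: arc_length_param0 arc.
- exact: arc_length_param_end arc.
- by move=> s _ sL; exact: arc_length_param_in arc _ sL.
- by move=> s t _ st tL; exact: arc_length_param_lipschitz arc _ _ st tL.
Qed.

Lemma lipschitz_path_continuous U x y L d : lipschitz_path U x y L d ->
  {within `[0, L], continuous d}.
Proof.
move=> [_ _ _ _ lip]; apply/subspace_continuousP => s /= sL.
apply/cvgrPdist_lt => e e0; rewrite /prop_near1 /within /=.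
apply/nbhs_ballP; exists e => //= t; rewrite /ball /= => st tL.
apply: le_lt_trans st; move: sL tL; rewrite !in_itv /= => /andP[s0 sL] /andP[t0 tL].
case: (lerP s t) => [st|/ltW ts].
  by rewrite distrC; exact: lip.
exact: lip.
Qed.

Lemma path_cost_measurable U x y L d : open U -> U <> setT ->
  lipschitz_path U x y L d ->
  measurable_fun `[0, L] (fun s => ((bdist U (d s))^-1)%:E).
Proof.
move=> oU UT path; apply/measurable_EFinP.
apply: subspace_continuous_measurable_fun => //.
have /subspace_continuousP dc := lipschitz_path_continuous path.
apply/subspace_continuousP => s sL; apply: cvgV.
  case: path => _ _ _ Ud _; move: sL; rewrite /= in_itv /= => /andP[s0 sL].
  by rewrite gt_eqF // bdist_gt0 //; exact: Ud.
apply: (cvg_comp _ _ (dc s sL)); exact: bdist_continuous.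
Qed.

Lemma unit_speed_rectifiable U x y L d : unit_speed_arc U x y L d ->
  rectifiable_arc U x y 0 L d.
Proof.
move=> [path inj len]; have [L0 d0 dL Ud lip] := path; split=> //.
- split; first exact: lipschitz_path_continuous path.
  move=> u v; rewrite !in_itv /= => /andP[u0 uL] /andP[v0 vL] duv.
  have [uv|vu|//] := ltgtP u v; first by case: (inj _ _ u0 uv vL).
  by case: (inj _ _ v0 vu uL).
- by move=> w [s /=]; rewrite in_itv /= => /andP[s0 sL] <-; exact: Ud.
- by rewrite len ?lexx // ltey.
Qed.

Lemma qh_length_unit_speed U x y L d : unit_speed_arc U x y L d ->
  qh_length U 0 L d = path_cost U L d.
Proof.
move=> [[L0 _ _ _ _] inj len]; rewrite /qh_length len //=.
apply: eq_integral => s; rewrite inE /= in_itv /= => /andP[s0 sL].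
congr ((bdist U (d _))^-1%:E).
suff -> : [set t | t \in `[0, L] /\ (s%:E <= curve_length d 0 t)%E] = `[s, L]%classic.
  by rewrite inf_itv // bnd_simp.
apply/seteqP; split=> t /=; rewrite !in_itv /=.
  by move=> [/andP[t0 tL]]; rewrite len // lee_fin => ->.
move=> /andP[st tL]; have t0 : 0 <= t by lra.
by rewrite len // lee_fin st t0 tL.
Qed.

Lemma qh_dist_unit_speed U x y L d : unit_speed_arc U x y L d ->
  (qh_dist U x y <= path_cost U L d)%E.
Proof.
move=> arc; apply: ereal_inf_lbound; exists 0, L, d; split.
  exact: unit_speed_rectifiable.
by rewrite (qh_length_unit_speed arc).
Qed.

End UnitSpeed.

(** * Prolonging an arc by a segment *)

Section Extension.
Context {R : realType} {E : normedModType R}.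
Implicit Types (U : set E) (x y z : E) (d : R -> E) (L : R).

Local Notation mu := (@lebesgue_measure R).

Lemma closed_segment y z : closed [set y + u *: (z - y) | u in `[0 : R, 1]].
Proof.
apply: compact_closed; first exact: norm_hausdorff.
apply: continuous_compact; last exact: segment_compact.
apply: continuous_subspaceT => u; apply: cvgD; first exact: cvg_cst.
by apply: cvgZr_tmp; exact: cvg_id.
Qed.

Lemma first_hit_segment U x y z L d : lipschitz_path U x y L d ->
  exists t v, [/\ 0 <= t, t <= L, 0 <= v <= 1, d t = y + v *: (z - y) &
    forall s u, 0 <= s -> s < t -> 0 <= u <= 1 -> d s <> y + u *: (z - y)].
Proof.
move=> [L0 d0 dL _ lip].
pose S := [set y + u *: (z - y) | u in `[0 : R, 1]].
pose A := [set s : R | [/\ 0 <= s, s <= L & S (d s)]].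
have AL : A L.
  by split=> //; exists 0; rewrite /= ?in_itv /= ?lexx ?ler01 // scale0r addr0.
have lbA : has_lbound A by exists 0 => s [].
have t0 : 0 <= inf A by apply: lb_le_inf; [exists L|move=> s []].
have tL : inf A <= L by apply: ge_inf.
have : S (d (inf A)).
  apply: contrapT => nS.
  have : nbhs (d (inf A)) (~` S).
    by apply: open_nbhs_nbhs; split=> //; apply: closed_openC; exact: closed_segment.
  move=> /nbhs_ballP[e /= e0 He].
  have lt_e : inf A < inf A + e by rewrite ltrDl.
  have [s [s0 sL Sds] se] := inf_lt (ex_intro _ _ AL) lt_e.
  have ts : inf A <= s by apply: ge_inf.
  apply: (He (d s)) Sds; rewrite -ball_normE /= distrC.
  by apply: le_lt_trans (lip _ _ t0 ts sL) _; rewrite ltrBlDl.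
move=> [v + vE]; rewrite /= in_itv /= => v01; exists (inf A), v; split=> // s u s0 st u01 dsE.
suff : inf A <= s by rewrite leNgt st.
apply: ge_inf => //; split=> //; first exact: le_trans (ltW st) tL.
by exists u; rewrite /= ?in_itv.
Qed.

(** Concatenation with a segment need not give an arc. Leaving the arc at the
    first moment it meets the segment restores injectivity and only discards
    pieces of the path, so that the cost does not increase. *)
Lemma unit_speed_extend U x y z L d m : open U -> U <> setT ->
  unit_speed_arc U x y L d -> 0 < m ->
  (forall u, 0 <= u <= 1 ->
    U (y + u *: (z - y)) /\ m <= bdist U (y + u *: (z - y))) ->
  exists L' d', unit_speed_arc U x z L' d' /\
    (path_cost U L' d' <= path_cost U L d + (`|z - y| / m)%:E)%E.
Proof.
move=> oU UT arc m0 seg.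
have [path inj len] := arc; have [L0 d0 dL Ud lip] := path.
have bd0 w : (0 <= ((bdist U w)^-1)%:E :> \bar R)%E by rewrite lee_fin invr_ge0 bdist_ge0.
case: (eqVneq z y) => [->|zy].
  by exists L, d; split=> //; rewrite subrr normr0 mul0r adde0.
have h0 : 0 < `|z - y| by rewrite normr_gt0 subr_eq0.
set h := `|z - y| in h0 *.
have [t [v [t0 tL /andP[v0 v1] dtE first]]] := first_hit_segment z path.
pose p u := y + u *: (z - y).
have pB u w : p u - p w = (u - w) *: (z - y).
  by rewrite /p opprD addrACA subrr add0r -scalerBl.
have p_dist u w : u <= w -> `|p w - p u| = (w - u) * h.
  by move=> uw; rewrite pB normrZ ger0_norm // subr_ge0.
pose L' := t + (1 - v) * h.
pose q s := v + (s - t) / h.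
pose d' s := if s <= t then d s else p (q s).
have d'1 s : s <= t -> d' s = d s by rewrite /d' => ->.
have d't s : t <= s -> d' s = p (q s).
  rewrite /d' le_eqVlt => /predU1P[<-|ts]; last by rewrite leNgt ts.
  by rewrite lexx dtE /p /q subrr mul0r addr0.
have qv s : t <= s -> v <= q s by move=> ts; rewrite lerDl divr_ge0 ?subr_ge0 // ltW.
have q1 s : s <= L' -> q s <= 1.
  by rewrite /L' -lerBlDl -ler_pdivrMr // /q; lra.
have q01 s : t <= s -> s <= L' -> 0 <= q s <= 1.
  by move=> ts sL; rewrite q1 // andbT (le_trans v0) // qv.
have qB s s' : q s' - q s = (s' - s) / h by rewrite /q; lra.
have tL' : t <= L' by rewrite lerDl mulr_ge0 ?subr_ge0 // ltW.
have seg_dist s s' : t <= s -> s <= s' -> `|d' s' - d' s| = s' - s.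
  move=> ts ss'; rewrite !d't ?(le_trans ts) // p_dist ?qB ?mulfVK ?gt_eqF //.
  by rewrite -subr_ge0 qB divr_ge0 ?subr_ge0 // ltW.
have lip' s s' : 0 <= s -> s <= s' -> s' <= L' -> `|d' s' - d' s| <= s' - s.
  move=> s0 ss' s'L'.
  case: (lerP s' t) => [s't|/ltW ts'].
    rewrite !d'1 ?(le_trans ss') //; apply: lip => //; exact: le_trans s't tL.
  case: (lerP t s) => [ts|/ltW st]; first by rewrite seg_dist.
  have -> : d' s' - d' s = (d' s' - d' t) + (d' t - d' s) by rewrite addrA subrK.
  apply: le_trans (ler_normD _ _) _; rewrite seg_dist // !d'1 //.
  by have := lip _ _ s0 st tL; lra.
have path' : lipschitz_path U x z L' d'.
  split=> //; first exact: le_trans tL'.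
  - by rewrite d'1.
  - rewrite d't // /q /L' (addrC t) addrK mulfK ?gt_eqF // addrC subrK.
    by rewrite /p scale1r addrC subrK.
  - move=> s s0 sL'; case: (lerP s t) => [st|/ltW ts].
      by rewrite d'1 //; apply: Ud => //; exact: le_trans tL.
    by rewrite d't //; case: (seg (q s)) => //; exact: q01.
exists L', d'; split; first split=> //.
- move=> s s' s0 ss' s'L'; case: (lerP s' t) => [s't|ts'].
    rewrite !d'1 // ?(le_trans (ltW ss')) //; apply: inj => //; exact: le_trans tL.
  case: (lerP t s) => [ts|st].
    move=> /eqP; rewrite eq_sym -subr_eq0 -normr_eq0 seg_dist // ?(ltW ss') //.
    by rewrite subr_eq0 gt_eqF.
  rewrite d'1 ?(ltW st) // d't ?(ltW ts') //; apply: first => //.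
  by apply: q01 => //; exact: ltW.
- move=> s s0 sL'; apply/le_anti/andP; split.
    rewrite -[s in leRHS]subr0; apply: (@curve_length_le _ _ id) => u w u0 uw ws.
    by apply: lip' => //; exact: le_trans sL'.
  have lent u : 0 <= u -> u <= t -> (u%:E <= curve_length d' 0 u)%E.
    move=> u0 ut; rewrite (@eq_curve_length _ _ _ d) ?len //; first exact: le_trans tL.
    by move=> w _ wu; rewrite d'1 // (le_trans wu).
  case: (lerP s t) => [st|/ltW ts]; first exact: lent.
  apply: le_trans (curve_lengthD_chord d' t0 ts); rewrite seg_dist //.
  have := lent t t0 (lexx t); case: (curve_length d' 0 t) => [l| |] //.
    by rewrite -EFinD !lee_fin; lra.
  by move=> _; rewrite addye // leey.
rewrite /path_cost (ge0_integral_itv_cat t0 tL' (path_cost_measurable oU UT path')) //.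
apply: leeD.
- rewrite (@eq_integral _ _ _ mu _ (fun s => ((bdist U (d s))^-1)%:E)); last first.
    by move=> s; rewrite inE /= in_itv /= => /andP[_ st]; rewrite d'1.
  apply: ge0_subset_integral => //; first exact: path_cost_measurable path.
  by move=> s /=; rewrite !in_itv /= => /andP[-> st]; exact: le_trans tL.
- apply: le_trans (integral_itvoc_le (k := m^-1) tL' _ _) _.
  + apply: measurable_funS (path_cost_measurable oU UT path') => //.
    move=> s /=; rewrite !in_itv /= => /andP[ts ->]; rewrite andbT.
    exact: le_trans (ltW ts).
  + move=> s /andP[ts sL']; rewrite bd0 lee_fin /= d't ?(ltW ts) //.
    have [_ mb] := seg _ (q01 _ (ltW ts) sL').
    by rewrite lef_pV2 // posrE // (lt_le_trans m0).
  + rewrite lee_fin mulrC ler_pM2r ?invr_gt0 //.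
    by rewrite /L' (addrC t) addrK; apply: ler_piMl; [exact: ltW|lra].
Qed.

Lemma qh_dist_le_arc U x y z m c : open U -> U <> setT ->
  (exists L d, unit_speed_arc U x y L d /\ (path_cost U L d <= c%:E)%E) ->
  0 < m ->
  (forall u, 0 <= u <= 1 ->
    U (y + u *: (z - y)) /\ m <= bdist U (y + u *: (z - y))) ->
  exists L d, unit_speed_arc U x z L d /\
    (path_cost U L d <= (c + `|z - y| / m)%:E)%E.
Proof.
move=> oU UT [L [d [arc cost]]] m0 seg.
have [L' [d' [arc' cost']]] := unit_speed_extend oU UT arc m0 seg.
exists L', d'; split=> //; apply: le_trans cost' _.
by rewrite EFinD leeD2r.
Qed.

End Extension.

(** * Quasihyperbolic distance through chains of short steps *)

Section Chains.
Context {R : realType} {E : normedModType R}.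
Implicit Types (U : set E) (x y z : E) (d : R -> E) (L c eta : R).

Local Notation mu := (@lebesgue_measure R).

Lemma unit_speed_point U x : U x ->
  unit_speed_arc U x x 0 (fun _ => x) /\ path_cost U 0 (fun _ => x) = 0%E.
Proof.
move=> Ux; split; last by rewrite /path_cost set_itv1 integral_set1.
split.
- by split=> // s t _ st _; rewrite subrr normr0 subr_ge0.
- by move=> s t s0 st t0; move: (le_lt_trans s0 st); rewrite ltNge t0.
- move=> t t0 tL; have -> : t = 0 by apply/le_anti/andP.
  apply/le_anti/andP; split; last exact: curve_length_ge0.
  rewrite -[0 in leRHS](subrr (0 : R)); apply: (@curve_length_le _ _ (fun=> 0)) => *.
  by rewrite !subrr normr0.
Qed.

Lemma qh_dist_segment U y z m : open U -> U <> setT -> 0 < m ->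
  (forall u, 0 <= u <= 1 ->
    U (y + u *: (z - y)) /\ m <= bdist U (y + u *: (z - y))) ->
  (qh_dist U y z <= (`|z - y| / m)%:E)%E.
Proof.
move=> oU UT m0 seg.
have Uy : U y by have [] := seg 0 _; rewrite ?lexx ?ler01 // scale0r addr0.
have [arc cost] := unit_speed_point Uy.
have [|L [d [arc' cost']]] := @qh_dist_le_arc _ _ U y y z m 0 oU UT _ m0 seg.
  by exists 0, (fun=> y); rewrite cost.
by apply: le_trans (qh_dist_unit_speed arc') _; rewrite add0r in cost'.
Qed.

(** Along the segment from [y] to [z] the distance to the boundary is at least
    [bdist U y - `|z - y|], so that the cost of a step bounds from above the
    quasihyperbolic length of the corresponding segment. The parameter [eta]
    controls the mesh. *)
Inductive chain U eta x : E -> R -> Prop :=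
| chain_nil : U x -> chain U eta x x 0
| chain_snoc y z c : chain U eta x y c ->
    `|z - y| <= eta * bdist U y -> `|z - y| < bdist U y ->
    chain U eta x z (c + `|z - y| / (bdist U y - `|z - y|)).

Lemma bdist_segment U y z u : open U -> U y -> `|z - y| < bdist U y ->
  0 <= u <= 1 ->
  U (y + u *: (z - y)) /\
  bdist U y - `|z - y| <= bdist U (y + u *: (z - y)).
Proof.
move=> oU Uy zy /andP[u0 u1].
have le_u : `|y - (y + u *: (z - y))| <= `|z - y|.
  rewrite opprD addrA subrr add0r normrN normrZ ger0_norm //.
  exact: ler_piMl.
split; first by apply: (ball_bdist oU Uy); exact: le_lt_trans zy.
by have := bdist_lipschitz U y (y + u *: (z - y)); lra.
Qed.

Lemma chain_in U eta x z c : open U -> chain U eta x z c -> U z.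
Proof.
move=> oU; elim=> // y w c' _ Uy _ wy.
by apply: (ball_bdist oU Uy); rewrite distrC.
Qed.

Lemma chain_arc U eta x z c : open U -> U <> setT -> chain U eta x z c ->
  exists L d, unit_speed_arc U x z L d /\ (path_cost U L d <= c%:E)%E.
Proof.
move=> oU UT; elim=> [Ux|y w c' ch IH _ wy].
  by have [arc cost] := unit_speed_point Ux; exists 0, (fun=> x); rewrite cost.
apply: qh_dist_le_arc => //; first by rewrite subr_gt0.
by move=> u u01; apply: bdist_segment => //; exact: chain_in ch.
Qed.

Lemma chain_qh_dist U eta x z c : open U -> U <> setT -> chain U eta x z c ->
  (qh_dist U x z <= c%:E)%E.
Proof.
move=> oU UT /(chain_arc oU UT)[L [d [arc cost]]].
exact: le_trans (qh_dist_unit_speed arc) cost.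
Qed.

Lemma chain_cat U eta x y z c c' : chain U eta x y c -> chain U eta y z c' ->
  chain U eta x z (c + c').
Proof.
move=> ch; elim=> [|w v b _ IH w1 w2]; first by rewrite addr0.
by rewrite addrA; exact: chain_snoc.
Qed.

Lemma chain1 U y z : U y -> `|z - y| < bdist U y ->
  chain U 1 y z (`|z - y| / (bdist U y - `|z - y|)).
Proof.
move=> Uy zy; rewrite -[X in chain _ _ _ _ X]add0r; apply: chain_snoc => //.
  exact: chain_nil.
by rewrite mul1r ltW.
Qed.

(** The path is sampled at equal parameter steps [h]. The distance to the
    boundary has a positive minimum along the path; once [h] is small compared
    with it, the cost of a step is at most [(1 + e) * h] times the smallest
    value of the integrand on the corresponding piece. *)
Lemma path_chain U x y L d e eta : open U -> U <> setT ->
  lipschitz_path U x y L d -> 0 < e -> e <= 1 -> 0 < eta ->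
  exists c, chain U eta x y c /\ (c%:E <= (1 + e)%:E * path_cost U L d)%E.
Proof.
move=> oU UT path e0 e1 eta0; have [L0 d0 dL Ud lip] := path.
have [m m0 mP] : exists2 m, 0 < m & forall s, 0 <= s -> s <= L -> m <= bdist U (d s).
  have cont : {within `[0, L], continuous (bdist U \o d)}.
    apply/subspace_continuousP => s sL.
    have /subspace_continuousP dc := lipschitz_path_continuous path.
    apply: (cvg_comp _ _ (dc s sL)); exact: bdist_continuous.
  have [s0 sL0 sP] := EVT_min L0 cont.
  exists (bdist U (d s0)).
    by move: sL0; rewrite in_itv /= => /andP[? ?]; apply: bdist_gt0 => //; exact: Ud.
  by move=> s s1 s2; apply: sP; rewrite in_itv /= s1.
(* [k <= e / 4] makes [(di + h) / (di - h)] at most [1 + e] below *)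
pose k := Num.min (e / 4) eta.
have k0 : 0 < k by rewrite lt_min eta0 andbT; lra.
have [ke keta] : k <= e / 4 /\ k <= eta by rewrite /k !ge_min !lexx orbT.
have km0 : 0 < k * m by exact: mulr_gt0.
pose N := Num.truncn (L / (k * m)).
have NP : L / (k * m) < N.+1%:R by exact: truncnS_gt.
pose h := L / N.+1%:R.
have h0 : 0 <= h by rewrite divr_ge0.
have hkm : h <= k * m.
  by rewrite /h ler_pdivrMr // mulrC -ler_pdivrMr // ltW.
pose s_ (i : nat) := h * i%:R.
have sN : s_ N.+1 = L by rewrite /s_ /h divfK.
have s0 i : 0 <= s_ i by rewrite mulr_ge0.
have sS i : s_ i.+1 = s_ i + h by rewrite /s_ -natr1 mulrDr mulr1.
suff H i : (i <= N.+1)%N -> exists c, chain U eta x (d (s_ i)) c /\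
    (c%:E <= (1 + e)%:E * path_cost U (s_ i) d)%E.
  by have := H N.+1 (leqnn _); rewrite sN dL.
elim: i => [_|i IH iN].
  rewrite /s_ mulr0 d0; exists 0; split.
    by apply: chain_nil; rewrite -d0; exact: Ud.
  by rewrite /path_cost set_itv1 integral_set1 mule0.
have [c [ch cost]] := IH (ltnW iN).
have siL : s_ i.+1 <= L by rewrite -sN ler_wpM2l // ler_nat.
have sii : s_ i <= s_ i.+1 by rewrite sS lerDl.
have mdi : m <= bdist U (d (s_ i)) by apply: mP => //; exact: le_trans siL.
set di := bdist U (d (s_ i)) in mdi *.
have step : `|d (s_ i.+1) - d (s_ i)| <= h.
  by apply: le_trans (lip _ _ (s0 i) sii siL) _; rewrite sS addrC addKr.
set l := `|d (s_ i.+1) - d (s_ i)| in step *.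
have km_di : k * m <= k * di by rewrite ler_pM2l.
have kdi : k * di <= di / 4.
  rewrite mulrC ler_pM2l ?(lt_le_trans m0) //; lra.
have ld : l < di by lra.
exists (c + l / (di - l)); split.
  apply: chain_snoc => //; apply: le_trans step _; apply: le_trans hkm _.
  by apply: le_trans km_di _; rewrite ler_wpM2r //; lra.
rewrite /path_cost (@ge0_integral_itv_cat _ _ 0 (s_ i)) //; last 2 first.
- apply: measurable_funS (path_cost_measurable oU UT path) => // s /=.
  by rewrite !in_itv /= => /andP[-> /le_trans]; exact.
- by move=> s _; rewrite lee_fin invr_ge0 bdist_ge0.
rewrite ge0_muleDr; last 2 first.
- by apply: integral_ge0 => s _; rewrite lee_fin invr_ge0 bdist_ge0.
- by apply: integral_ge0 => s _; rewrite lee_fin invr_ge0 bdist_ge0.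
rewrite EFinD; apply: leeD => //.
have dh0 : 0 < di + h by lra.
apply: (@le_trans _ _ ((1 + e)%:E * ((di + h)^-1 * (s_ i.+1 - s_ i))%:E)%E).
  rewrite -EFinM lee_fin sS (addrC (s_ i)) addrK.
  have -> : (1 + e) * ((di + h)^-1 * h) = (1 + e) * h / (di + h) by lra.
  rewrite ler_pdivrMr ?subr_gt0 // mulrAC ler_pdivlMr //.
  have ke4 : k * di <= e / 4 * di by rewrite ler_wpM2r //; lra.
  have hd : h <= e / 4 * di by lra.
  apply: (@le_trans _ _ (h * (di + h))); first by rewrite ler_wpM2r //; lra.
  rewrite [leRHS]mulrAC mulrC ler_wpM2r //.
  have : e * l <= e * h by rewrite ler_wpM2l // ltW.
  have : e * h <= h by rewrite ler_piMl.
  by nra.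
rewrite lee_wpmul2l //; first by rewrite lee_fin; lra.
apply: integral_itvoc_ge => //.
- by rewrite invr_ge0 ltW.
- apply: measurable_funS (path_cost_measurable oU UT path) => // s /=.
  rewrite !in_itv /= => /andP[si sL]; apply/andP; split; last exact: le_trans siL.
  by apply: le_trans (ltW si).
move=> s /andP[si sL].
have sL' : s <= L by exact: le_trans siL.
have s_ge0 : 0 <= s by exact: le_trans (ltW si).
have ms := mP _ s_ge0 sL'.
rewrite lee_fin lef_pV2 ?posrE //; last exact: lt_le_trans ms.
apply: le_trans (bdist_lipschitz U (d s) (d (s_ i))) _; rewrite lerD2l.
by apply: le_trans (lip _ _ (s0 i) (ltW si) sL') _; rewrite lerBlDl -sS.
Qed.

Lemma qh_dist_chain U x y c eta : open U -> U <> setT ->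
  (qh_dist U x y < c%:E)%E -> 0 < eta ->
  exists2 c', c' <= c & chain U eta x y c'.
Proof.
move=> oU UT lt_c eta0.
have /ereal_inf_lt[_ [a [b [g [arc ->]]]] lt_g] := lt_c.
have path := rectifiable_arc_lipschitz arc.
have cost0 : (0 <= qh_length U a b g)%E.
  by apply: integral_ge0 => s _; rewrite lee_fin invr_ge0 bdist_ge0.
case IE : (qh_length U a b g) cost0 lt_g => [I| |] //.
rewrite lee_fin lte_fin => I0 Ic.
have c0 : 0 < c by lra.
pose e := (c - I) / c.
have e0 : 0 < e by rewrite divr_gt0 // subr_gt0.
have e1 : e <= 1 by rewrite ler_pdivrMr // mul1r; lra.
have [c' [ch]] := path_chain oU UT path e0 e1 eta0.
rewrite -[path_cost _ _ _]/(qh_length U a b g) IE -EFinM lee_fin => c'I.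
exists c' => //; apply: le_trans c'I _; rewrite mulrDl mul1r.
have : e * I <= c - I.
  rewrite /e mulrAC ler_pdivrMr // ler_wpM2l // ?ltW //; lra.
lra.
Qed.

Lemma qh_dist_short U y z : open U -> U <> setT -> U y ->
  `|y - z| <= bdist U y / 2 -> (qh_dist U y z <= (2 * `|y - z| / bdist U y)%:E)%E.
Proof.
move=> oU UT Uy yz; have d0 := bdist_gt0 oU UT Uy.
rewrite distrC in yz *.
have lt_d : `|z - y| < bdist U y by lra.
apply: le_trans (chain_qh_dist oU UT (chain1 Uy lt_d)) _.
rewrite lee_fin ler_pdivrMr ?subr_gt0 //.
rewrite mulrAC ler_pdivlMr //.
by have := normr_ge0 (z - y); nra.
Qed.

Lemma qh_dist_trans U x y z (a b : R) : open U -> U <> setT ->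
  (qh_dist U x y <= a%:E)%E -> (qh_dist U y z <= b%:E)%E ->
  (qh_dist U x z <= (a + b)%:E)%E.
Proof.
move=> oU UT xy yz; apply/lee_addgt0Pr => e e0.
have e20 : 0 < e / 2 by rewrite divr_gt0.
have [|a' aa' cha] := @qh_dist_chain U x y (a + e / 2) 1 oU UT _ ltr01.
  by apply: le_lt_trans xy _; rewrite lte_fin ltrDl.
have [|b' bb' chb] := @qh_dist_chain U y z (b + e / 2) 1 oU UT _ ltr01.
  by apply: le_lt_trans yz _; rewrite lte_fin ltrDl.
apply: le_trans (chain_qh_dist oU UT (chain_cat cha chb)) _.
by rewrite -EFinD lee_fin; lra.
Qed.

(** Since [bdist U y <= bdist U x + `|y - x|], the slope of
    [ln (1 + `|y - x| / bdist U x)] as a function of [y] is at most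
    [1 / bdist U y]. *)
Lemma chain_ln U eta x z c : open U -> U <> setT -> chain U eta x z c ->
  ln (1 + `|z - x| / bdist U x) <= c.
Proof.
move=> oU UT ch; have Ux : U x by elim: ch.
have d0 := bdist_gt0 oU UT Ux.
elim: ch => [_|y w c' chy IH _ wy]; first by rewrite subrr normr0 mul0r addr0 ln1.
have Uy := chain_in oU chy; have dy0 := bdist_gt0 oU UT Uy.
set D := bdist U x in d0 IH *.
have lipy : bdist U y <= D + `|y - x|.
  by apply: bdist_lipschitz.
have A0 : 0 < D + `|y - x| by rewrite ltr_wpDr.
have -> : 1 + `|w - x| / D = (D + `|w - x|) / D by rewrite mulrDl divff // gt_eqF.
have IH' : ln ((D + `|y - x|) / D) <= c' by rewrite mulrDl divff ?gt_eqF.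
apply: (@le_trans _ _ (ln ((D + `|y - x| + `|w - y|) / D))).
  rewrite ler_ln ?posrE ?divr_gt0 // ?ltr_wpDr //.
  rewrite ler_pM2r ?invr_gt0 // -addrA lerD2l.
  by have := ler_normD (y - x) (w - y); rewrite [y - x + _]addrC subrKA.
have -> : (D + `|y - x| + `|w - y|) / D =
    (D + `|y - x|) / D * (1 + `|w - y| / (D + `|y - x|)).
  by field; rewrite !gt_eqF.
rewrite lnM ?posrE ?divr_gt0 //; last by rewrite ltr_wpDr // divr_ge0 // ltW.
apply: lerD => //; apply: le_trans (le_ln1Dx _) _.
  by apply: lt_le_trans (_ : 0 <= _); rewrite ?ltrN10 // divr_ge0 // ltW.
rewrite ler_wpM2l // lef_pV2 ?posrE // ?subr_gt0 //.
by have := normr_ge0 (w - y); lra.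
Qed.

Lemma qh_dist_ln U x y (c : R) : open U -> U <> setT ->
  (qh_dist U x y <= c%:E)%E -> ln (1 + `|y - x| / bdist U x) <= c.
Proof.
move=> oU UT xy; apply/ler_addgt0Pr => e e0.
have [|c' cc' ch] := @qh_dist_chain U x y (c + e) 1 oU UT _ ltr01.
  by apply: le_lt_trans xy _; rewrite lte_fin ltrDl.
exact: le_trans (chain_ln oU UT ch) cc'.
Qed.

End Chains.

(** * Detours around a point *)

Section Puncture.
Context {R : realType} {E : normedModType R}.
Implicit Types (G : set E) (u v w x p q : E).

Lemma ln_ge_ratio (t : R) : 0 <= t -> t / (1 + t) <= ln (1 + t).
Proof.
move=> t0; have t1 : 0 < 1 + t by lra.
have : ln (1 + t)^-1 <= (1 + t)^-1 - 1.
  have -> : (1 + t)^-1 = 1 + ((1 + t)^-1 - 1) by lra.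
  apply: le_trans (le_ln1Dx _) _; last by lra.
  by have : 0 < (1 + t)^-1 by [rewrite invr_gt0]; lra.
rewrite lnV ?posrE // => H.
have -> : t / (1 + t) = 1 - (1 + t)^-1 by field; rewrite gt_eqF.
lra.
Qed.

Lemma nonparallel_vector p : dim_ge2 E -> exists v, forall r : R, v <> r *: p.
Proof.
move=> [a [b ab]]; apply: contrapT => /forallNP H.
have [r ar] : exists r : R, a = r *: p by apply: contrapT => /forallNP /H.
have [s bs] : exists s : R, b = s *: p by apply: contrapT => /forallNP /H.
have [s0 _] : s = 0 /\ - r = 0.
  by apply: ab; rewrite ar bs scaleNr !scalerA mulrC subrr.
have := ab 0 1; rewrite bs s0 !scale0r scaler0 addr0 => /(_ erefl)[_ /eqP].
by rewrite oner_eq0.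
Qed.

(** Lines are proximinal, so that Riesz's lemma holds with constant [1] for
    the line spanned by [p]. *)
Lemma orthogonal_vector p : dim_ge2 E -> p != 0 ->
  exists w, `|w| = `|p| /\ forall r : R, `|p| <= `|w + r *: p|.
Proof.
move=> dimE p0; have [v vP] := nonparallel_vector p dimE.
have np : 0 < `|p| by rewrite normr_gt0.
pose f (r : R) := `|v - r *: p|.
have f_cont : continuous f.
  move=> r; apply: cvg_norm; apply: cvgB; first exact: cvg_cst.
  by apply: cvgZr_tmp; exact: cvg_id.
pose M := 2 * `|v| / `|p|.
have M0 : 0 <= M by rewrite divr_ge0 // mulr_ge0.
have MM : - M <= M by lra.
have [r0 r0M minM] := EVT_min MM (continuous_subspaceT f_cont).
have min_f r : f r0 <= f r.
  case: (lerP `|r| M) => [rM|Mr].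
    by apply: minM; rewrite in_itv /= -ler_norml.
  have : f r0 <= f 0 by apply: minM; rewrite in_itv /= oppr_le0 M0.
  move=> /le_trans; apply; rewrite /f scale0r subr0.
  have : 2 * `|v| <= `|r| * `|p| by rewrite -ler_pdivrMr // ltW.
  by have := lerB_dist (r *: p) v; rewrite normrZ distrC; lra.
have f0 : 0 < f r0 by rewrite normr_gt0 subr_eq0; apply/eqP/vP.
pose k := `|p| / f r0.
have k0 : 0 < k by rewrite divr_gt0.
have kf : k * f r0 = `|p| by rewrite /k mulfVK // gt_eqF.
exists (k *: (v - r0 *: p)); split; first by rewrite normrZ gtr0_norm // kf.
move=> r; have -> : k *: (v - r0 *: p) + r *: p = k *: (v - (r0 - r / k) *: p).
  rewrite !scalerBr scalerBl scalerBr !scalerA opprB addrA addrAC -addrA.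
  by rewrite [k * (r / k)]mulrC mulfVK ?gt_eqF // addrA.
by rewrite normrZ gtr0_norm // -kf ler_pM2l //; exact: min_f.
Qed.

(** The midpoint of the segment has norm at least [rho / 2], which settles the
    points near it; at the other points the two summands of the convex
    combination have norms that are far apart. *)
Lemma segment_avoids0 (rho : R) p q s : `|p| = rho -> `|q| = rho ->
  rho <= `|p + q| -> 0 <= s <= 1 -> rho / 4 <= `|p + s *: (q - p)|.
Proof.
move=> pr qr pq /andP[s0 s1].
have xE : p + s *: (q - p) = (1 - s) *: p + s *: q.
  by rewrite scalerBl scale1r scalerBr addrA addrAC.
set X := p + _ in xE *.
have n1 : `|(1 - s) *: p| = (1 - s) * rho by rewrite normrZ ger0_norm ?pr; lra.
have n2 : `|s *: q| = s * rho by rewrite normrZ ger0_norm ?qr; lra.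
have l1 : `|(1 - 2 * s) * rho| <= `|X|.
  rewrite ler_norml; apply/andP; split.
    have := lerB_normD (s *: q) ((1 - s) *: p); rewrite [s *: q + _]addrC -xE n1 n2; lra.
  have := lerB_normD ((1 - s) *: p) (s *: q); rewrite -xE n1 n2; lra.
have rho0 : 0 <= rho by rewrite -pr.
have : `|p + q| <= 2 * `|X| + 2 * `|(1 - 2 * s) * rho|.
  have -> : p + q = 2 *: X + ((2 * s - 1) *: p + (1 - 2 * s) *: q).
    rewrite xE scalerDr !scalerA addrACA -!scalerDl.
    have -> : 2 * (1 - s) + (2 * s - 1) = 1 :> R by lra.
    have -> : 2 * s + (1 - 2 * s) = 1 :> R by lra.
    by rewrite !scale1r.
  apply: le_trans (ler_normD _ _) _; apply: lerD.
    by rewrite normrZ ger0_norm.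
  apply: le_trans (ler_normD _ _) _.
  by rewrite !normrZ pr qr (distrC (2 * s)) (ger0_norm rho0); lra.
lra.
Qed.

(** The vector [w] of [orthogonal_vector] is far from being antipodal to
    [p], and so is [- w]; one of the two is far from being antipodal to [q]. *)
Lemma sphere_detour (rho : R) p q : dim_ge2 E -> 0 < rho -> `|p| = rho -> `|q| = rho ->
  exists w, [/\ `|w| = rho,
    forall s, 0 <= s <= 1 -> rho / 4 <= `|p + s *: (w - p)| &
    forall s, 0 <= s <= 1 -> rho / 4 <= `|w + s *: (q - w)|].
Proof.
move=> dimE rho0 pr qr.
have p0 : p != 0 by rewrite -normr_gt0 pr.
have [w [wr wP]] := orthogonal_vector dimE p0; rewrite pr in wr wP.
have H w' : `|w'| = rho -> rho <= `|p + w'| -> rho <= `|w' + q| ->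
    [/\ `|w'| = rho, forall s, 0 <= s <= 1 -> rho / 4 <= `|p + s *: (w' - p)| &
    forall s, 0 <= s <= 1 -> rho / 4 <= `|w' + s *: (q - w')|].
  by move=> *; split=> // s s01; exact: segment_avoids0.
case: (lerP rho `|w + q|) => wq.
  by exists w; apply: H => //; have := wP 1; rewrite scale1r addrC.
exists (- w); apply: H; rewrite ?normrN //.
  by have := wP (-1); rewrite scaleN1r distrC.
have := lerB_normD (2 *: w) (- w + q).
have -> : 2 *: w + (- w + q) = w + q.
  by rewrite addrA -[- w]scaleN1r -scalerDl (_ : 2 + -1 = 1 :> R) ?scale1r //; lra.
rewrite normrZ ger0_norm // wr; lra.
Qed.

Context (G : set E) (x : E) (r0 : R).
Hypotheses (oG : open G) (GT : G <> setT).
Hypothesis clean : forall p, 0 < `|p - x| -> `|p - x| <= r0 ->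
  G p /\ `|p - x| <= bdist G p.

(** Along a ray the cost is the logarithm of the ratio of the radii; splitting
    at factors of [2] obtains it, up to the factor [2], from segments. *)
Lemma radial_qh_dist p (a b : R) : p != 0 -> 0 < a -> a <= b -> b * `|p| <= r0 ->
  (qh_dist G (x + a *: p)%R (x + b *: p)%R <= (2 * ln (b / a))%:E)%E /\
  (qh_dist G (x + b *: p)%R (x + a *: p)%R <= (2 * ln (b / a))%:E)%E.
Proof.
move=> p0 a0 ab br.
have np : 0 < `|p| by rewrite normr_gt0.
have [n] : exists n, b <= 2 ^+ n * a.
  exists (Num.truncn (b / a)).+1; rewrite -ler_pdivrMr //.
  apply: le_trans (ltW (truncnS_gt _)) _; rewrite -natrX ler_nat.
  exact/ltnW/ltn_expl.
have short a' b' : 0 < a' -> a' <= b' -> b' <= 2 * a' -> b' <= b ->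
  (qh_dist G (x + a' *: p)%R (x + b' *: p)%R <= (2 * ln (b' / a'))%:E)%E /\
  (qh_dist G (x + b' *: p)%R (x + a' *: p)%R <= (2 * ln (b' / a'))%:E)%E.
  move=> a'0 ab' b2 b'b.
  have segP c : a' <= c -> c <= b' -> G (x + c *: p) /\ a' * `|p| <= bdist G (x + c *: p).
    move=> ac cb; have c0 : 0 < c by exact: lt_le_trans ac.
    have nc : `|x + c *: p - x| = c * `|p| by rewrite addrC addKr normrZ gtr0_norm.
    have [||Gc] := clean (p := x + c *: p); rewrite nc.
    - exact: mulr_gt0.
    - by apply: le_trans br; rewrite ler_pM2r // (le_trans cb).
    - by move=> le_c; split=> //; apply: (le_trans _ le_c); rewrite ler_pM2r.
  have cost : (b' - a') * `|p| / (a' * `|p|) <= 2 * ln (b' / a').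
    have t0 : 0 <= b' / a' - 1 by rewrite subr_ge0 ler_pdivlMr // mul1r.
    have t1 : b' / a' - 1 <= 1 by rewrite lerBlDr ler_pdivrMr //; lra.
    have -> : (b' - a') * `|p| / (a' * `|p|) = b' / a' - 1.
      by field; rewrite !gt_eqF.
    have := ln_ge_ratio t0; rewrite (addrC 1) subrK => H.
    have : (b' / a' - 1) / 2 <= (b' / a' - 1) / (b' / a').
      rewrite ler_wpM2l // lef_pV2 ?posrE ?divr_gt0 //; last by exact: lt_le_trans ab'.
      lra.
    lra.
  have ap0 : 0 < a' * `|p| by exact: mulr_gt0.
  have dif c c' : x + c' *: p - (x + c *: p) = (c' - c) *: p.
    by rewrite opprD addrACA subrr add0r scalerBl.
  split.
  - apply: le_trans (qh_dist_segment oG GT ap0 _) _.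
      move=> u /andP[u0 u1]; rewrite dif scalerA -addrA -scalerDl; apply: segP.
        by rewrite lerDl mulr_ge0 // subr_ge0.
      by rewrite -lerBrDl ler_piMl // subr_ge0.
    by rewrite lee_fin dif normrZ ger0_norm // subr_ge0.
  - apply: le_trans (qh_dist_segment oG GT ap0 _) _.
      move=> u /andP[u0 u1]; rewrite dif scalerA -addrA -scalerDl; apply: segP.
        by have : u * (b' - a') <= b' - a' by [rewrite ler_piMl // subr_ge0]; lra.
      by have : 0 <= u * (b' - a') by [rewrite mulr_ge0 // subr_ge0]; lra.
    by rewrite lee_fin dif normrZ distrC ger0_norm // subr_ge0.
elim: n a a0 ab => [|n IH] a a0 ab bn; first by apply: short => //; lra.
case: (lerP b (2 * a)) => [b2|/ltW b2]; first exact: short.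
have a20 : 0 < 2 * a by lra.
have b0 : 0 < b by exact: lt_le_trans ab.
have [||f1 f2] := short a (2 * a) a0 _ _ b2; [lra|lra|].
have [|g1 g2] := IH (2 * a) a20 b2; first by rewrite mulrA -exprSr.
have lnE : 2 * ln (b / a) = 2 * ln (2 * a / a) + 2 * ln (b / (2 * a)).
  rewrite -mulrDr -lnM ?posrE ?divr_gt0 //; congr (2 * ln _).
  by field; rewrite gt_eqF.
split; rewrite lnE; first exact: qh_dist_trans f1 g1.
by rewrite [2 * ln _ + _]addrC; exact: qh_dist_trans g2 f2.
Qed.

(** A radial move brings [u] to the sphere through [v]; the remaining two
    segments have length at most [2 * rho] and stay at distance at least
    [rho / 4] from the puncture, which costs [8] for each. *)
Lemma punctured_ball_qh_dist u v (K : R) : dim_ge2 E ->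
  0 < `|u - x| -> `|u - x| <= r0 -> 0 < `|v - x| -> `|v - x| <= r0 ->
  `|u - x| <= K * `|v - x| -> `|v - x| <= K * `|u - x| ->
  (qh_dist G u v <= (16 + 2 * ln K)%:E)%E.
Proof.
move=> dimE u0 ur v0 vr uv vu.
pose p := u - x; pose q := v - x; pose rho := `|q|.
have p0 : p != 0 by rewrite -normr_gt0.
have K0 : 0 < K by rewrite -(pmulr_lgt0 _ u0); exact: lt_le_trans vu.
pose a := rho / `|p|.
have a0 : 0 < a by rewrite divr_gt0.
pose u' := x + a *: p.
have uE : u = x + 1 *: p by rewrite scale1r addrC subrK.
have nu' : `|a *: p| = rho by rewrite normrZ gtr0_norm // mulfVK // gt_eqF.
have radial : (qh_dist G u u' <= (2 * ln K)%:E)%E.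
  have lnK t : 0 < t -> t <= K -> (2 * ln t <= 2 * ln K)%R.
    by move=> t0 tK; rewrite ler_pM2l // ler_ln ?posrE.
  rewrite uE /u'; case: (lerP 1 a) => [a1|/ltW a1].
    have [|+ _] := @radial_qh_dist p 1 a p0 ltr01 a1.
      by rewrite /a mulfVK // gt_eqF.
    move=> /le_trans; apply; rewrite lee_fin lnK ?divr1 //.
    by rewrite ler_pdivrMr.
  have [|_] := @radial_qh_dist p a 1 p0 a0 a1; first by rewrite mul1r.
  move=> /le_trans; apply; rewrite lee_fin lnK ?divr_gt0 //.
  by rewrite div1r invf_div ler_pdivrMr.
have [w [wr seg1 seg2]] := sphere_detour dimE v0 nu' (erefl rho).
have rho4 : 0 < rho / 4 by rewrite divr_gt0.
have segcost p1 p2 : `|p1| = rho -> `|p2| = rho ->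
    (forall s, 0 <= s <= 1 -> rho / 4 <= `|p1 + s *: (p2 - p1)|) ->
    (qh_dist G (x + p1)%R (x + p2)%R <= 8%:E)%E.
  move=> n1 n2 far; have dif : x + p2 - (x + p1) = p2 - p1.
    by rewrite opprD addrACA subrr add0r.
  apply: le_trans (qh_dist_segment oG GT rho4 _) _.
    move=> s s01; rewrite dif -addrA; set z := p1 + _.
    have zE : x + z - x = z by rewrite addrC addKr.
    have rz : rho / 4 <= `|z| by exact: far.
    have [||Gz] := clean (p := x + z); rewrite zE.
    - exact: lt_le_trans rz.
    - apply: le_trans vr; rewrite -/q -/rho.
      have -> : z = (1 - s) *: p1 + s *: p2.
        by rewrite /z scalerBl scale1r scalerBr addrA addrAC.
      apply: le_trans (ler_normD _ _) _; move/andP: s01 => [s0 s1].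
      by rewrite !normrZ n1 n2 !ger0_norm //; lra.
    - by move=> dz; split=> //; exact: le_trans dz.
  rewrite lee_fin dif ler_pdivrMr //.
  apply: le_trans (ler_normB _ _) _; rewrite n1 n2; lra.
have -> : 16 + 2 * ln K = 2 * ln K + 8 + 8 by lra.
have vE : v = x + q by rewrite addrC subrK.
rewrite vE; apply: (qh_dist_trans oG GT _ (segcost w q _ _ _)) => //.
by apply: (qh_dist_trans oG GT radial (segcost _ w _ _ _)).
Qed.

End Puncture.

(** * Dependence on the domain *)

Section Monotone.
Context {R : realType} {E : normedModType R}.
Implicit Types (U V : set E) (x y z : E).

Lemma bdist_subset U V z : open U -> U <> setT -> open V -> V `<=` U -> V z ->
  bdist V z <= bdist U z.
Proof.
move=> oU UT oV VU Vz; apply: bdist_ge => //; first exact: VU.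
by move=> w zw; apply: VU; exact: (ball_bdist oV Vz).
Qed.

Lemma qh_dist_subset U V x y : open U -> U <> setT -> open V -> V `<=` U ->
  (qh_dist U x y <= qh_dist V x y)%E.
Proof.
move=> oU UT oV VU; apply: le_ereal_inf_tmp => _ [a [b [g [arc ->]]]].
have VT : V <> setT by move=> VT; apply: UT; apply/seteqP; split=> // z _; apply: VU; rewrite VT.
have pathV := rectifiable_arc_lipschitz arc.
have arcU : rectifiable_arc U x y a b g.
  by case: arc => *; split=> //; exact: subset_trans VU.
have pathU := rectifiable_arc_lipschitz arcU.
apply: le_trans (ereal_inf_lbound (ex_intro _ a (ex_intro _ b
  (ex_intro _ g (conj arcU erefl))))) _.
rewrite /qh_length; apply: ge0_le_integral => //.
- by move=> s _; rewrite lee_fin invr_ge0 bdist_ge0.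
- exact: path_cost_measurable pathU.
- exact: path_cost_measurable pathV.
move=> s /=; rewrite in_itv /= => /andP[s0 sL].
have Vs : V (arc_length_param g a b s) by case: pathV => _ _ _ + _; exact.
rewrite lee_fin lef_pV2 ?posrE ?bdist_gt0 //; last exact: VU.
exact: bdist_subset.
Qed.

Lemma qh_dist_connected U : U !=set0 ->
  (forall x y, U x -> U y -> (qh_dist U x y < +oo)%E) -> connected U.
Proof.
move=> [x Ux] fin; have <- : connected_component U x = U.
  apply/seteqP; split=> [|y Uy]; first exact: connected_component_sub.
  have /ereal_inf_lt[_ [a [b [g [[ab [gc _] sub [ga gb] _] _]]]] _] := fin x y Ux Uy.
  apply: (connected_component_max (B := g @` `[a, b])) => //.
  - by exists a; rewrite /= ?in_itv /= ?lexx.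
  - by apply: connected_continuous_connected gc; exact: segment_connected.
  - by exists b; rewrite /= ?in_itv /= ?lexx ?ab.
exact: component_connected.
Qed.

End Monotone.

(** * Homeomorphisms of the half-line *)

Section Homeo.
Context {R : realType}.
Implicit Types (f psi phi : R -> R).

Lemma within_continuous_scale f (a b : R) : 0 <= b ->
  {within `[0, +oo[, continuous f} ->
  {within `[0, +oo[, continuous (fun t => a * f (b * t))}.
Proof.
move=> b0 /subspace_continuousP fc; apply/subspace_continuousP => t /= t0.
apply: cvgMl_tmp.
have bt : `[0, +oo[%classic (b * t).
  by move: t0; rewrite /= !in_itv /= !andbT => t0; exact: mulr_ge0.
apply: cvg_comp (fc _ bt) => A.
rewrite /nbhs /= /within /= => HA.
have bcont : (fun s : R => b * s) @ t --> b * t by apply: cvgMl_tmp; exact: cvg_id.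
have := bcont _ HA; rewrite /nbhs /= => H; near=> s => s0.
have : ([set x | `[0, +oo[%classic x -> A x]) (b * s) by near: s; exact: H.
apply; move: s0; rewrite /= !in_itv /= !andbT; exact: mulr_ge0.
Unshelve. all: by end_near. Qed.

Lemma half_line_homeo_scale psi (a b : R) : 0 < a -> 0 < b ->
  half_line_homeo psi -> half_line_homeo (fun t => a * psi (b * t)).
Proof.
move=> a0 b0 [[maps inj surj] psic [phi psiK phic]].
have ge0 t : (`[0, +oo[%classic : set R) t <-> 0 <= t.
  by rewrite /= in_itv /= andbT.
have bt t : 0 <= t -> 0 <= b * t by move=> t0; exact: mulr_ge0 (ltW b0) t0.
have inv0 : 0 <= a^-1 by rewrite invr_ge0 ltW.
split.
- split.
  + by move=> t /ge0 t0; apply/ge0; rewrite mulr_ge0 ?(ltW a0) //; apply/ge0/maps/ge0/bt.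
  + move=> s t /set_mem/ge0 s0 /set_mem/ge0 t0 /(mulfI (lt0r_neq0 a0)) /inj.
    by move=> /(_ (mem_set (iffRL (ge0 _) (bt _ s0))) (mem_set (iffRL (ge0 _) (bt _ t0))))
      /(mulfI (lt0r_neq0 b0)).
  + move=> s /ge0 s0; have [t /ge0 t0 ts] := surj (a^-1 * s) (iffRL (ge0 _) (mulr_ge0 inv0 s0)).
    exists (b^-1 * t); first by apply/ge0; rewrite mulr_ge0 // invr_ge0 ltW.
    by rewrite mulrA divff ?gt_eqF // mul1r ts mulrA divff ?gt_eqF // mul1r.
- by apply: within_continuous_scale => //; exact: ltW.
- exists (fun t => b^-1 * phi (a^-1 * t)); last exact: within_continuous_scale.
  move=> t /ge0 t0; rewrite mulKf ?gt_eqF // psiK ?mulKf ?gt_eqF //.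
  by apply/ge0; exact: bt.
Qed.

Lemma half_line_homeo_ge0 psi (t : R) : half_line_homeo psi -> 0 <= t -> 0 <= psi t.
Proof.
move=> [[maps _ _] _ _] t0; have := maps t; rewrite /= !in_itv /= !andbT; exact.
Qed.

Lemma half_line_homeo_le psi (s t : R) : half_line_homeo psi -> 0 <= s -> s <= t ->
  psi s <= psi t.
Proof.
move=> hom s0 st; have [[maps inj surj] psic _] := hom.
have inI (r : R) : 0 <= r -> r \in `[0, +oo[ by rewrite in_itv /= andbT.
have inj' : {in `[0, +oo[ &, injective psi}.
  by move=> x y xI yI; apply: inj; rewrite inE.
have t0 := le_trans s0 st.
case: (itv_continuous_inj_mono psic inj') => mono.
  move: st; rewrite le_eqVlt => /predU1P[->//|st].
  by apply: ltW; apply: mono => //; exact: inI.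
(* a decreasing map of the half-line onto itself would be bounded by its value at 0 *)
have p0 := half_line_homeo_ge0 hom (lexx 0).
have [r] := surj (psi 0 + 1) ltac:(by rewrite /= in_itv /= andbT; lra).
rewrite /= in_itv /= andbT => r0 pr.
have pr0 : psi 0 < psi r by rewrite pr ltrDl.
move: r0; rewrite le_eqVlt => /predU1P[r0|r0]; first by move: pr0; rewrite -r0 ltxx.
by have := lt_trans pr0 (mono r 0 (inI _ (ltW r0)) (inI _ (lexx 0)) r0); rewrite ltxx.
Qed.

End Homeo.

(** * Logarithmic growth of the control function *)

Section UniformGrowth.
Context {R : realType} {E : normedModType R}.

(** Moving from a fixed point straight to the boundary, the ratio that enters
    the definition of uniformity takes every value [t >= 0], while the
    quasihyperbolic distance is at least [ln (1 + t)]. *)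
Lemma uniform_domain_ln (psi : R -> R) (U : set E) (t : R) :
  uniform_domain psi U -> 0 <= t -> ln (1 + t) <= psi t.
Proof.
move=> [hom [oU [z Uz] _] UT unif] t0.
have [w nUw] : exists w, ~ U w.
  apply: contrapT => /forallNP H; apply: UT; apply/seteqP; split=> // w _.
  exact: contrapT (H w).
have [b [bU _ ray]] := first_exit oU Uz nUw.
have dz := bdist_gt0 oU UT Uz.
have bz : 0 < `|b - z|.
  by rewrite distrC; apply: lt_le_trans (bdist_le z bU).
pose p s := z + s *: (b - z).
have np s s' : `|p s - p s'| = `|s - s'| * `|b - z|.
  by rewrite /p opprD addrACA subrr add0r -scalerBl normrZ.
have p0 : p 0 = z by rewrite /p scale0r addr0.
have p1 : p 1 = b by rewrite /p scale1r addrC subrK.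
pose g s := s * `|b - z| - t * Num.min (bdist U z) (bdist U (p s)).
have gc : continuous g.
  have pc : continuous p.
    move=> r; apply: cvgD; first exact: cvg_cst.
    by apply: cvgZr_tmp; exact: cvg_id.
  have dpc : continuous (bdist U \o p).
    by move=> r; apply: continuous_comp; [exact: pc|exact: bdist_continuous].
  move=> s; apply: cvgB; first by apply: cvgMr_tmp; exact: cvg_id.
  apply: cvgMl_tmp.
  exact: (@continuous_min R _ (fun=> bdist U z) (bdist U \o p) s (cvg_cst _) (dpc s)).
have db : bdist U b <= 0 by have := bdist_le b bU; rewrite subrr normr0.
have g1 : 0 < g 1.
  rewrite /g mul1r p1 subr_gt0; apply: le_lt_trans bz.
  by rewrite mulr_ge0_le0 // ge_min db orbT.
have g0 : g 0 <= 0.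
  by rewrite /g mul0r sub0r oppr_le0 mulr_ge0 // le_min !bdist_ge0.
have [|s] := IVT ler01 (continuous_subspaceT gc) (v := 0).
  by rewrite ge_min le_max g0 (ltW g1) orbT.
rewrite in_itv /= => /andP[s0 s1] gs.
have s_lt1 : s < 1.
  by rewrite lt_neqAle s1 andbT; apply/eqP => sE; move: g1; rewrite -sE gs ltxx.
have Ups : U (p s) by exact: ray.
have dps := bdist_gt0 oU UT Ups.
have norm_ps : `|z - p s| = t * Num.min (bdist U z) (bdist U (p s)).
  rewrite -[z in `|z - _|]p0 np sub0r normrN ger0_norm //.
  by move/eqP: gs; rewrite subr_eq0 => /eqP.
have m0 : 0 < Num.min (bdist U z) (bdist U (p s)) by rewrite lt_min dz.
have tE : `|z - p s| / Num.min (bdist U z) (bdist U (p s)) = t.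
  by rewrite norm_ps mulfK // gt_eqF.
have [le_d|/ltW le_d] := lerP (bdist U z) (bdist U (p s)).
  have := qh_dist_ln oU UT (unif _ _ Uz Ups); rewrite tE distrC.
  by rewrite (min_idPl le_d) in tE; rewrite tE.
have := qh_dist_ln oU UT (unif _ _ Ups Uz); rewrite (distrC (p s) z) minC tE.
by rewrite (min_idPr le_d) in tE; rewrite tE.
Qed.

End UniformGrowth.

(** * Removing a separated set *)

(** The time taken by linear arithmetic grows quickly with the number of
    inequalities in the context. *)
Ltac drop_ineqs := repeat match goal with H : is_true _ |- _ => clear H end.

Section Complement.
Context {R : realType} {E : normedModType R}.
Implicit Types (u v w x y z a b : E).
Context (D P C : set E).
Hypotheses (dimE : dim_ge2 E) (oD : open D) (DT : D <> setT).
Hypotheses (cC : closed C) (PE : P = D `&` C).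
Hypothesis sepP : forall x y, P x -> P y -> x <> y ->
  ((2^-1 : R)%:E <= qh_dist D x y)%E.
Let G := D `\` P.

(** A segment from [x] to a point within [bdist D x / 3] would have
    quasihyperbolic length less than [1 / 2]. *)
Lemma separated_norm x y : P x -> P y -> x <> y -> bdist D x / 3 <= `|x - y|.
Proof.
move=> Px Py xy; rewrite leNgt; apply/negP => close.
have Dx : D x by move: Px; rewrite PE => -[].
have d0 := bdist_gt0 oD DT Dx.
rewrite distrC in close.
have lt_d : `|y - x| < bdist D x by lra.
have ch := chain1 Dx lt_d.
have := le_trans (sepP Px Py xy) (chain_qh_dist oD DT ch).
rewrite lee_fin ler_pdivlMr ?subr_gt0 //; lra.
Qed.

Lemma G_D z : G z -> D z. Proof. by case. Qed.

Lemma open_G : open G.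
Proof.
have -> : G = D `&` ~` C.
  by rewrite /G PE setDIr setDv set0U setDE.
by apply: openI => //; exact: closed_openC.
Qed.

Lemma G_neqT : G <> setT.
Proof.
move=> GT; apply: DT; apply/seteqP; split=> // z _.
by apply: G_D; rewrite GT.
Qed.

Lemma bdist_G_le_D z : G z -> bdist G z <= bdist D z.
Proof. by apply: bdist_subset => //; [exact: open_G|exact: G_D]. Qed.

Lemma bdist_G_le_P z x : G z -> P x -> bdist G z <= `|z - x|.
Proof.
move=> Gz Px; rewrite leNgt; apply/negP => zx.
by have [] := ball_bdist open_G Gz zx.
Qed.

Lemma bdist_G_ge z r : G z -> r <= bdist D z -> (forall x, P x -> r <= `|z - x|) ->
  r <= bdist G z.
Proof.
move=> Gz rD rP; apply: bdist_ge => //; [exact: open_G|exact: G_neqT|].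
move=> w zw; split; first by apply: (ball_bdist oD (G_D Gz)); exact: lt_le_trans rD.
by move=> /rP; rewrite leNgt zw.
Qed.

Lemma bdist_G_gt0 z : G z -> 0 < bdist G z.
Proof. by move=> Gz; apply: bdist_gt0 => //; [exact: open_G|exact: G_neqT]. Qed.

(** Near a point of [P] the complement is a punctured ball, since the other
    points of [P] are at distance at least [bdist D x / 3]. *)
Lemma punctured_ball x z : P x -> 0 < `|z - x| -> `|z - x| <= bdist D x / 6 ->
  G z /\ `|z - x| <= bdist G z.
Proof.
move=> Px zx0 zx.
have Dx : D x by move: Px; rewrite PE => -[].
have far y : P y -> `|z - x| <= `|z - y|.
  move=> Py; case: (pselect (x = y)) => [<-//|xy].
  have := separated_norm Px Py xy.
  by have := ler_distD z x y; rewrite (distrC x z); lra.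
have Gz : G z.
  split; first by apply: (ball_bdist oD Dx); rewrite distrC; lra.
  by move=> /far; rewrite subrr normr0 leNgt zx0.
split=> //; apply: bdist_G_ge => //.
by have := bdist_lipschitz D x z; rewrite (distrC x z); lra.
Qed.

Let mind u v := Num.min (bdist G u) (bdist G v).

Let mind_gt0 u v : G u -> G v -> 0 < mind u v.
Proof. by move=> Gu Gv; rewrite /mind lt_min !bdist_G_gt0. Qed.

(** If [bdist G u] is small compared with [bdist D u], it is due to a point [x]
    of [P]; the constant [20] ensures that both [u] and [v] lie in the punctured
    ball around [x] in which detours are possible. *)
Lemma qh_dist_G_detour u v : G u -> G v -> `|u - v| <= bdist D u / 20 ->
  bdist G u / 2 < `|u - v| ->
  (qh_dist G u v <= (16 + 2 * ln (1 + `|u - v| / mind u v))%:E)%E.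
Proof.
move=> Gu Gv uv far; have d0 := bdist_G_gt0 Gu; have m0 := mind_gt0 Gu Gv.
have D0 := bdist_gt0 oD DT (G_D Gu).
have [x [Px ux]] : exists x, P x /\ `|u - x| < bdist D u / 10.
  apply: contrapT => /forallNP H.
  have : bdist D u / 10 <= bdist G u.
    apply: bdist_G_ge => //; first lra.
    by move=> x Px; rewrite leNgt; apply/negP => ux; apply: (H x).
  lra.
have dx := bdist_lipschitz D u x.
have vx : `|v - x| <= bdist D x / 6.
  by have := ler_distD u v x; rewrite (distrC v u); lra.
have gu := bdist_G_le_P Gu Px; have gv := bdist_G_le_P Gv Px.
have mu' : mind u v <= bdist G u by rewrite /mind ge_min lexx.
have mv : mind u v <= bdist G v by rewrite /mind ge_min lexx orbT.
have ratio r : mind u v <= r -> r + `|u - v| <= (1 + `|u - v| / mind u v) * r.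
  move=> mr; rewrite mulrDl mul1r lerD2l mulrAC ler_pdivlMr //.
  by rewrite ler_wpM2l.
apply: (@punctured_ball_qh_dist _ _ G x (bdist D x / 6)) => //.
- exact: open_G.
- exact: G_neqT.
- by move=> p p0 pr; exact: punctured_ball.
- lra.
- lra.
- lra.
- apply: le_trans (ratio _ _); last lra.
  by rewrite [leRHS]addrC; exact: ler_distD.
- apply: le_trans (ratio _ _); last lra.
  by rewrite [leRHS]addrC (distrC u v); exact: ler_distD.
Qed.

Let ratio_ge0 u v : G u -> G v -> 0 <= `|u - v| / mind u v.
Proof. by move=> Gu Gv; rewrite divr_ge0 // ltW // mind_gt0. Qed.

Lemma qh_dist_G_local u v : G u -> G v -> `|u - v| <= bdist D u / 20 ->
  (qh_dist G u v <= (16 + 2 * ln (1 + `|u - v| / mind u v))%:E)%E.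
Proof.
move=> Gu Gv uv; case: (lerP `|u - v| (bdist G u / 2)) => near.
  2: exact: qh_dist_G_detour.
apply: le_trans (qh_dist_short open_G G_neqT Gu near) _; rewrite lee_fin.
have : 2 * `|u - v| / bdist G u <= 1.
  by rewrite ler_pdivrMr ?bdist_G_gt0 // mul1r; lra.
have : 0 <= ln (1 + `|u - v| / mind u v) by rewrite ln_ge0 // lerDl ratio_ge0.
lra.
Qed.

(** A short step has cost linear in its ratio, which is comparable to the
    logarithm; a longer one has ratio at least [1 / 2], so that the constant
    [16] is at most [48 * ln (1 + t)]. *)
Lemma qh_dist_G_local_ln u v : G u -> G v -> `|u - v| <= bdist D u / 20 ->
  (qh_dist G u v <= (50 * ln (1 + `|u - v| / mind u v))%:E)%E.
Proof.
move=> Gu Gv uv; have d0 := bdist_G_gt0 Gu; have m0 := mind_gt0 Gu Gv.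
set t := `|u - v| / mind u v; have t0 : 0 <= t := ratio_ge0 Gu Gv.
have lnt := ln_ge_ratio t0.
have tau : `|u - v| / bdist G u <= t.
  by rewrite ler_wpM2l // lef_pV2 ?posrE // /mind ge_min lexx.
have t1 : 0 < 1 + t by lra.
case: (lerP `|u - v| (bdist G u / 2)) => near.
  apply: le_trans (qh_dist_short open_G G_neqT Gu near) _; rewrite lee_fin.
  set s := `|u - v| / bdist G u in tau.
  have s0 : 0 <= s by rewrite divr_ge0 // ltW.
  have s2 : s <= 2^-1 by rewrite ler_pdivrMr // mulrC.
  have sE : 2 * `|u - v| / bdist G u = 2 * s by rewrite mulrA.
  have lns := ln_ge_ratio s0.
  have : s / 2 <= s / (1 + s).
    by rewrite ler_wpM2l // lef_pV2 ?posrE //; lra.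
  have : ln (1 + s) <= ln (1 + t) by rewrite ler_ln ?posrE //; lra.
  rewrite sE; lra.
apply: le_trans (qh_dist_G_detour Gu Gv uv near) _; rewrite lee_fin -/t.
have s2 : 2^-1 < `|u - v| / bdist G u by rewrite ltr_pdivlMr // mulrC.
have : 3^-1 <= t / (1 + t) by rewrite ler_pdivlMr //; lra.
lra.
Qed.

(** A substitute in [G] for a point of [D]: moving from [a] to [b] is cheap in
    [D], and at [b] the distances to the two boundaries are comparable. *)
Definition good (mu : R) a b :=
  [/\ G b, `|b - a| <= 2 * mu * bdist D a & mu * bdist D a <= bdist G b].

(** At most one point [x] of [P] is close to [a]. Any step of length
    [2 * mu * bdist D a] leads away from [x], and it is too short to come close
    to another point of [P]. *)
Lemma exists_good (mu : R) a : D a -> 0 < mu -> mu <= 13^-1 -> exists b, good mu a b.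
Proof.
move=> Da mu0 mu1; have d0 := bdist_gt0 oD DT Da.
have md0 : 0 < mu * bdist D a by exact: mulr_gt0.
have md1 : mu * bdist D a <= bdist D a / 13 by rewrite mulrC ler_pM2l.
case: (pselect (exists x, P x /\ `|x - a| < mu * bdist D a)); last first.
  move=> /forallNP H.
  have far x : P x -> mu * bdist D a <= `|a - x|.
    by move=> Px; rewrite distrC leNgt; apply/negP => xa; apply: (H x).
  have Ga : G a by split=> // /far; rewrite subrr normr0 leNgt md0.
  exists a; split=> //; first by rewrite subrr normr0 -mulrA; lra.
  by apply: bdist_G_ge => //; lra.
move=> [x [Px xa]].
have [p p0] : exists p : E, p != 0.
  have [e1 [e2 ind]] := dimE; exists e1; apply/eqP => e10.
  have := ind 1 0; rewrite e10 scaler0 scale0r addr0 => /(_ erefl)[/eqP].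
  by rewrite oner_eq0.
have np : 0 < `|p| by rewrite normr_gt0.
pose k := 2 * mu * bdist D a / `|p|.
pose b := a + k *: p.
have ba : `|b - a| = 2 * mu * bdist D a.
  rewrite /b addrC addKr normrZ ger0_norm ?divr_ge0 // ?mulfVK ?gt_eqF //.
  by rewrite -mulrA; lra.
rewrite -[2 * mu * _]mulrA in ba.
have Dx : D x by move: Px; rewrite PE => -[].
have dx := bdist_lipschitz D a x; rewrite distrC in dx.
have db := bdist_lipschitz D a b; rewrite (distrC a b) in db.
have far y : P y -> mu * bdist D a <= `|b - y|.
  move=> Py; have tri := ler_distD b a y; rewrite (distrC a b) in tri.
  have tri' := ler_distD y x b.
  case: (pselect (x = y)) => [<-|xy].
    by have := ler_distD x b a; lra.
  have := separated_norm Px Py xy.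
  have := ler_distD a x y.
  by have := ler_distD b a y; rewrite (distrC a b); lra.
have Gb : G b.
  split; first by apply: (ball_bdist oD Da); rewrite distrC ba; lra.
  by move=> /far; rewrite subrr normr0 leNgt md0.
exists b; split=> //; first by rewrite ba -mulrA.
by apply: bdist_G_ge => //; lra.
Qed.

(* small enough for good points of two points at relative distance [64^-1] to
   be within the range of [qh_dist_G_local] *)
Let mu : R := 128^-1.

Let mu_gt0 : 0 < mu. Proof. by rewrite invr_gt0. Qed.

Let mu_le : mu <= 13^-1. Proof. by rewrite /mu; lra. Qed.

Lemma qh_dist_G_good_step a a' e e' : D a -> D e -> good mu a a' -> good mu e e' ->
  `|e - a| <= (64^-1 + 1024^-1) * bdist D a -> (qh_dist G a' e' <= 22%:E)%E.
Proof.
move=> Da De [Ga' aa' ga'] [Ge' ee' ge'] ea.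
have d0 := bdist_gt0 oD DT Da.
have de := bdist_lipschitz D e a.
have de' := bdist_lipschitz D a e; rewrite (distrC a e) in de'.
have da' := bdist_lipschitz D a a'; rewrite (distrC a a') in da'.
have ae' : `|a' - e'| <= `|a' - a| + `|e - a| + `|e' - e|.
  have := ler_distD a a' e'; have := ler_distD e a e'.
  by rewrite (distrC a e) (distrC e e'); drop_ineqs; lra.
rewrite /mu in aa' ga' ee' ge'.
have close : `|a' - e'| <= bdist D a * (49 / 1000).
  by move: ae' aa' ee' ea de d0; drop_ineqs; lra.
apply: le_trans (qh_dist_G_local Ga' Ge' _) _; first by move: close da' aa' d0; drop_ineqs; lra.
have m0 := mind_gt0 Ga' Ge'.
have m1 : bdist D a / 131 <= mind a' e'.
  rewrite /mind le_min; apply/andP; split; first by move: ga' d0; drop_ineqs; lra.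
  by move: ge' de' ea d0; drop_ineqs; lra.
rewrite lee_fin.
(* the constant of the lemma is [16 + 2 * ln 8] with [ln 2 <= 1] *)
have ln8 : ln (1 + `|a' - e'| / mind a' e') <= ln (2 ^+ 3).
  rewrite ler_ln ?posrE ?exprn_gt0 //; last first.
    by rewrite ltr_wpDr // divr_ge0 // ltW.
  have : `|a' - e'| / mind a' e' <= 7.
    by rewrite ler_pdivrMr //; move: close m1 d0; drop_ineqs; lra.
  have -> : (2 : R) ^+ 3 = 8 by drop_ineqs; rewrite !exprS expr0; lra.
  by drop_ineqs; lra.
have ln2 : ln (2 : R) <= 1 by apply: (@le_ln1Dx R 1); drop_ineqs; lra.
by move: ln8 ln2; rewrite lnXn //; drop_ineqs; lra.
Qed.

(** Induction along the chain, with [q] the last anchor and [r] a bound for the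
    distance from [q] on the scale of [bdist D q]. While [r] stays below
    [64^-1] the anchor is kept, and [r] grows by at most [9 / 8] times the cost
    of the step; otherwise the anchor moves to the current point, at a price of
    [22] in [G] that is paid by resetting [r] to [0]. *)
Lemma chain_D_good a a' z c : D a -> good mu a a' -> chain D 2048^-1 a z c ->
  exists q q' r, [/\ D q, good mu q q', 0 <= r <= 64^-1,
    `|z - q| <= r * bdist D q &
    (qh_dist G a' q' <= (22 * 64 * (9 / 8 * c - r))%:E)%E].
Proof.
move=> Da ga; elim=> [_|y w b ch IH wy1 wy2].
  exists a, a', 0; split=> //; rewrite ?lexx ?invr_ge0 ?ler0n //.
    by rewrite subrr normr0 mul0r.
  rewrite mulr0 subrr mulr0.
  by apply: chain_qh_dist (chain_nil 1 _); [exact: open_G|exact: G_neqT|case: ga].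
have [q [q' [r [Dq gq /andP[r0 r1] yq kq]]]] := IH.
have Dy := chain_in oD ch; have dy0 := bdist_gt0 oD DT Dy.
have dq0 := bdist_gt0 oD DT Dq.
set l := `|w - y| in wy1 wy2 *; set s := l / (bdist D y - l).
have l0 : 0 <= l := normr_ge0 _.
have ls : l <= s * bdist D y.
  rewrite /s mulrAC ler_pdivlMr ?subr_gt0 // ler_wpM2l //.
  by rewrite lerBlDr lerDl.
have s0 : 0 <= s by rewrite divr_ge0 // subr_ge0 ltW.
have rq : r * bdist D q <= 64^-1 * bdist D q by rewrite ler_pM2r.
have dyq : bdist D y <= bdist D q * (65 / 64).
  by have := bdist_lipschitz D y q; move: yq rq; drop_ineqs; lra.
have wq : `|w - q| <= l + `|y - q| by exact: ler_distD.
have ls' : l <= 9 / 8 * s * bdist D q.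
  have : s * bdist D y <= s * (bdist D q * (65 / 64)) by rewrite ler_wpM2l.
  have : 0 <= s * bdist D q by rewrite mulr_ge0 // ltW.
  by move: ls; drop_ineqs; lra.
case: (lerP (r + 9 / 8 * s) 64^-1) => rs.
  exists q, q', (r + 9 / 8 * s); split=> //.
  - by rewrite rs andbT; move: r0 s0; drop_ineqs; lra.
  - by rewrite mulrDl; move: wq ls' yq; drop_ineqs; lra.
  - by apply: le_trans kq _; rewrite lee_fin; drop_ineqs; lra.
have Dw : D w by apply: (ball_bdist oD Dy); rewrite distrC.
have [w' gw] := exists_good Dw mu_gt0 mu_le.
exists w, w', 0; split=> //; rewrite ?lexx ?invr_ge0 ?ler0n //.
  by rewrite subrr normr0 mul0r.
have step : (qh_dist G q' w' <= 22%:E)%E.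
  apply: (qh_dist_G_good_step Dq Dw gq gw).
  by move: rq dyq wq wy1 yq dq0; drop_ineqs; lra.
apply: le_trans (qh_dist_trans open_G G_neqT kq step) _.
by rewrite lee_fin; move: rs; drop_ineqs; lra.
Qed.

Lemma qh_dist_G_good a a' z z' c : D a -> D z -> good mu a a' -> good mu z z' ->
  (qh_dist D a z < c%:E)%E -> (qh_dist G a' z' <= (1584 * c + 22)%:E)%E.
Proof.
move=> Da Dz ga gz /(qh_dist_chain oD DT) - /(_ 2048^-1)[|c' cc' ch].
  by drop_ineqs; lra.
have [q [q' [r [Dq gq /andP[r0 r1] zq kq]]]] := chain_D_good Da ga ch.
have step : (qh_dist G q' z' <= 22%:E)%E.
  apply: (qh_dist_G_good_step Dq Dz gq gz); have d0 := bdist_gt0 oD DT Dq.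
  have : r * bdist D q <= 64^-1 * bdist D q by rewrite ler_pM2r.
  by move: zq d0; drop_ineqs; lra.
apply: le_trans (qh_dist_trans open_G G_neqT kq step) _.
by rewrite lee_fin; move: cc' r0; drop_ineqs; lra.
Qed.

(** A point far from [z] on the scale [bdist D z] sees [z] and a good point
    next to [z] at comparable relative distances. *)
Lemma qh_dist_G_good_end z z' (t : R) : D z -> G z -> good mu z z' -> 0 <= t ->
  bdist D z / 21 <= t * bdist G z ->
  (qh_dist G z z' <= (20 + 2 * ln (1 + t))%:E)%E /\
  (qh_dist G z' z <= (20 + 2 * ln (1 + t))%:E)%E.
Proof.
move=> Dz Gz [Gz' zz' gz'] t0 tz.
have d0 := bdist_gt0 oD DT Dz.
have dz' := bdist_lipschitz D z z'; rewrite (distrC z z') in dz'.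
rewrite /mu in zz' gz'.
have g0 := bdist_G_gt0 Gz.
have t1 : 0 < 1 + t by move: t0; drop_ineqs; lra.
have m0 := mind_gt0 Gz Gz'.
have ratio : 2 * ln (1 + `|z - z'| / mind z z') <= 4 + 2 * ln (1 + t).
  have : ln (1 + `|z - z'| / mind z z') <= ln (3 * (1 + t)).
    rewrite ler_ln ?posrE; last 2 first.
    - by rewrite ltr_wpDr // divr_ge0 // ltW.
    - exact: mulr_gt0.
    suff : `|z - z'| / mind z z' <= 2 + t by move: t0; drop_ineqs; lra.
    rewrite ler_pdivrMr // (distrC z z') /mind.
    case: (lerP (bdist G z) (bdist G z')) => _.
      by rewrite mulrDl; move: zz' tz g0 d0; drop_ineqs; lra.
    have : 0 <= t * bdist G z' by rewrite mulr_ge0 // ltW // bdist_G_gt0.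
    by rewrite mulrDl; move: zz' gz' d0; drop_ineqs; lra.
  rewrite lnM ?posrE //.
  have : ln (3 : R) <= 2.
    have -> : (3 : R) = 1 + 2 by drop_ineqs; lra.
    by apply: le_ln1Dx; drop_ineqs; lra.
  by drop_ineqs; lra.
have cost : 16 + 2 * ln (1 + `|z - z'| / mind z z') <= 20 + 2 * ln (1 + t).
  by move: ratio; drop_ineqs; lra.
split.
- apply: le_trans (qh_dist_G_local Gz Gz' _) _; last by rewrite lee_fin.
  by rewrite distrC; move: zz' d0; drop_ineqs; lra.
- apply: le_trans (qh_dist_G_local Gz' Gz _) _; first by move: zz' dz' d0; drop_ineqs; lra.
  by rewrite lee_fin distrC /mind minC.
Qed.

(** Far apart points are joined through good points. The ratio [t] is then at
    least [1 / 20] and hence [21 * ln (1 + t)] is at least [1], which absorbs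
    the constants; the factor [5 / 4] makes room for a strict inequality. *)
Lemma qh_dist_G_le u v (k : R) : G u -> G v -> 0 <= k ->
  (qh_dist D u v <= k%:E)%E -> ln (1 + `|u - v| / mind u v) <= k ->
  (qh_dist G u v <= (2 ^+ 12 * k)%:E)%E.
Proof.
move=> Gu Gv k0 kD kln; have m0 := mind_gt0 Gu Gv.
have -> : (2 : R) ^+ 12 = 4096 by drop_ineqs; rewrite !exprS expr0; lra.
have [Du Dv] := (G_D Gu, G_D Gv).
have [du dv] := (bdist_gt0 oD DT Du, bdist_gt0 oD DT Dv).
case: (lerP `|u - v| (bdist D u / 20)) => far_u.
  apply: le_trans (qh_dist_G_local_ln Gu Gv far_u) _.
  by rewrite lee_fin; move: k0 kln; drop_ineqs; lra.
set t := `|u - v| / mind u v in kln; have t0 : 0 <= t := ratio_ge0 Gu Gv.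
have tm : t * mind u v = `|u - v| by rewrite /t mulfVK // gt_eqF.
have tge w : mind u v <= bdist G w -> `|u - v| <= t * bdist G w.
  by move=> mw; rewrite -tm ler_wpM2l.
have tu : `|u - v| <= t * bdist G u by apply: tge; rewrite /mind ge_min lexx.
have tv : `|u - v| <= t * bdist G v by apply: tge; rewrite /mind ge_min lexx orbT.
have t20 : 20^-1 <= t.
  have gD := bdist_G_le_D Gu.
  rewrite -(ler_pM2r du) mulrC; apply: le_trans (ltW far_u) _.
  by apply: le_trans tu _; rewrite ler_wpM2l.
have ln21 : 21^-1 <= ln (1 + t).
  apply: le_trans (ln_ge_ratio t0).
  by rewrite ler_pdivlMr; move: t20; drop_ineqs; lra.
have dvu := bdist_lipschitz D v u; rewrite distrC in dvu.
have [u' gu] := exists_good Du mu_gt0 mu_le.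
have [v' gv] := exists_good Dv mu_gt0 mu_le.
have end_u : bdist D u / 21 <= t * bdist G u by move: tu far_u du; drop_ineqs; lra.
have end_v : bdist D v / 21 <= t * bdist G v by move: tv far_u dvu; drop_ineqs; lra.
have [e1 _] := qh_dist_G_good_end Du Gu gu t0 end_u.
have [_ e2] := qh_dist_G_good_end Dv Gv gv t0 end_v.
have mid : (qh_dist G u' v' <= (1584 * (5 / 4 * k) + 22)%:E)%E.
  apply: (qh_dist_G_good Du Dv gu gv); apply: le_lt_trans kD _.
  by rewrite lte_fin; move: ln21 kln; drop_ineqs; lra.
have oG := open_G; have GT := G_neqT.
apply: le_trans (qh_dist_trans oG GT (qh_dist_trans oG GT e1 mid) e2) _.
by rewrite lee_fin; move: ln21 kln; drop_ineqs; lra.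
Qed.

(** Points that are far apart are moved to good points, which is cheap in [D]
    and changes the ratio in the definition of uniformity by a bounded factor. *)
Lemma qh_dist_D_le (psi : R -> R) u v : half_line_homeo psi ->
  (forall t, 0 <= t -> ln (1 + t) <= psi t) ->
  (forall z w, G z -> G w ->
    (qh_dist G z w <= (psi (`|z - w| / mind z w))%:E)%E) ->
  D u -> D v ->
  (qh_dist D u v <=
    (3 * psi (2 ^+ 7 * (`|u - v| / Num.min (bdist D u) (bdist D v))))%:E)%E.
Proof.
move=> hom lnpsi unif Du Dv.
have -> : (2 : R) ^+ 7 = 128 by drop_ineqs; rewrite !exprS expr0; lra.
have [du dv] := (bdist_gt0 oD DT Du, bdist_gt0 oD DT Dv).
set m := Num.min _ _; set t := `|u - v| / m.
have m0 : 0 < m by rewrite /m lt_min du.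
have [mu_ mv] : m <= bdist D u /\ m <= bdist D v by rewrite /m !ge_min !lexx orbT.
have t0 : 0 <= t by rewrite divr_ge0 // ltW.
have t128 : 0 <= 128 * t by apply: mulr_ge0.
have tm : t * m = `|u - v| by rewrite /t mulfVK // gt_eqF.
case: (lerP `|u - v| (bdist D u / 2)) => near.
  apply: le_trans (qh_dist_short oD DT Du near) _; rewrite lee_fin.
  set s := `|u - v| / bdist D u.
  have s0 : 0 <= s by rewrite divr_ge0 // ltW.
  have st : s <= t by rewrite ler_wpM2l // lef_pV2.
  have s2 : s <= 2^-1 by rewrite ler_pdivrMr // mulrC.
  have s128 : 0 <= 128 * s by apply: mulr_ge0.
  have lns : 128 * s / 65 <= ln (1 + 128 * s).
    apply: le_trans (ln_ge_ratio s128).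
    by rewrite ler_wpM2l // lef_pV2 ?posrE; move: s0 s2; drop_ineqs; lra.
  have lnst : ln (1 + 128 * s) <= ln (1 + 128 * t).
    by rewrite ler_ln ?posrE; move: s0 st; drop_ineqs; lra.
  have := lnpsi _ t128; have -> : 2 * `|u - v| / bdist D u = 2 * s by rewrite mulrA.
  by move: lns lnst s0; drop_ineqs; lra.
have dvu := bdist_lipschitz D v u; rewrite (distrC v u) in dvu.
have mu0 : 0 < 64^-1 :> R by rewrite invr_gt0.
have mu1 : 64^-1 <= 13^-1 :> R by drop_ineqs; lra.
have [u' [Gu' uu' gu']] := exists_good Du mu0 mu1.
have [v' [Gv' vv' gv']] := exists_good Dv mu0 mu1.
have dv' := bdist_lipschitz D v v'; rewrite (distrC v v') in dv'.
have mid : (qh_dist D u' v' <= (psi (128 * t))%:E)%E.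
  apply: le_trans (qh_dist_subset _ _ oD DT open_G G_D) _.
  apply: le_trans (unif _ _ Gu' Gv') _; rewrite lee_fin.
  have m'0 := mind_gt0 Gu' Gv'.
  apply: half_line_homeo_le => //; first by rewrite divr_ge0 // ltW.
  have mm' : m / 64 <= mind u' v'.
    rewrite /mind le_min; apply/andP; split.
      by move: gu' mu_; drop_ineqs; lra.
    by move: gv' mv; drop_ineqs; lra.
  rewrite ler_pdivrMr //; apply: (@le_trans _ _ (128 * t * (m / 64))).
    have -> : 128 * t * (m / 64) = 2 * (t * m) by drop_ineqs; lra.
    have := ler_distD u u' v'; have := ler_distD v u v'.
    rewrite (distrC v v') tm; move: du near dvu uu' vv'; drop_ineqs; lra.
  by rewrite ler_wpM2l.
have end_u : (qh_dist D u u' <= (16^-1)%:E)%E.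
  rewrite distrC in uu'.
  apply: le_trans (qh_dist_short oD DT Du _) _; first by move: uu' du; drop_ineqs; lra.
  by rewrite lee_fin ler_pdivrMr //; move: uu' du; drop_ineqs; lra.
have end_v : (qh_dist D v' v <= (8^-1)%:E)%E.
  have Dv' := G_D Gv'; have dv'0 := bdist_gt0 oD DT Dv'.
  apply: le_trans (qh_dist_short oD DT Dv' _) _.
    by move: vv' dv' dv; drop_ineqs; lra.
  by rewrite lee_fin ler_pdivrMr //; move: vv' dv' dv; drop_ineqs; lra.
apply: le_trans (qh_dist_trans oD DT (qh_dist_trans oD DT end_u mid) end_v) _.
have t2 : 2^-1 <= t.
  rewrite -(ler_pM2r m0) tm.
  by move: near mu_; drop_ineqs; lra.
have ln64 : 64 / 65 <= ln (1 + 128 * t).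
  apply: le_trans (ln_ge_ratio t128).
  by rewrite ler_pdivlMr; move: t2; drop_ineqs; lra.
by rewrite lee_fin; have := lnpsi _ t128; move: ln64; drop_ineqs; lra.
Qed.

End Complement.

Theorem theorem1 (R : realType) (E : completeNormedModType R)
    (dimE : dim_ge2 E)
    (D : set E) (domD : domain D) (DT : D <> setT)
    (P : set E) (PD : P `<=` D) (cntP : countable P)
    (clP : exists2 C : set E, closed C & P = D `&` C)
    (sepP : forall x y : E, P x -> P y -> x <> y ->
              ((2^-1 : R)%:E <= qh_dist D x y)%E) :
  let G := D `\` P in
  [/\ (exists psi : R -> R, uniform_domain psi D) <->
        (exists psi1 : R -> R, uniform_domain psi1 G),
      forall psi : R -> R, half_line_homeo psi -> uniform_domain psi D ->
        uniform_domain (fun t => 2 ^+ 12 * psi t) G &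
      forall psi1 : R -> R, half_line_homeo psi1 -> uniform_domain psi1 G ->
        uniform_domain (fun t => 3 * psi1 (2 ^+ 7 * t)) D].
Proof.
move=> G; have [C cC PE] := clP; have [oD [z Dz] _] := domD.
have oG : open G := open_G oD cC PE.
have GT : G <> setT := @G_neqT _ _ _ P DT.
have GD : G `<=` D by move=> w [].
have G0 : G !=set0.
  have mu0 : 0 < 13^-1 :> R by rewrite invr_gt0.
  have [w [Gw _ _]] := exists_good dimE oD DT cC PE sepP Dz mu0 (lexx _).
  by exists w.
have partI psi : uniform_domain psi D -> uniform_domain (fun t => 2 ^+ 12 * psi t) G.
  move=> unifD; have [hom _ _ unif] := unifD.
  have bound u v : G u -> G v -> (qh_dist G u v <=
      (2 ^+ 12 * psi (`|u - v| / Num.min (bdist G u) (bdist G v)))%:E)%E.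
    move=> Gu Gv; have m0 : 0 < Num.min (bdist G u) (bdist G v).
      by rewrite lt_min !bdist_gt0.
    have t0 : 0 <= `|u - v| / Num.min (bdist G u) (bdist G v).
      by rewrite divr_ge0 // ltW.
    apply: (qh_dist_G_le dimE oD DT cC PE sepP) => //.
    - exact: half_line_homeo_ge0.
    - apply: le_trans (unif _ _ (GD _ Gu) (GD _ Gv)) _; rewrite lee_fin.
      have mle : Num.min (bdist G u) (bdist G v) <= Num.min (bdist D u) (bdist D v).
        by rewrite le_min !ge_min !bdist_subset ?orbT.
      apply: half_line_homeo_le => //.
        by rewrite divr_ge0 // ltW // (lt_le_trans m0).
      by rewrite ler_wpM2l // lef_pV2 ?posrE // (lt_le_trans m0).
    - exact: (uniform_domain_ln unifD t0).
  split=> //; last split=> //.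
  - have := @half_line_homeo_scale R psi (2 ^+ 12) 1.
    under eq_fun do rewrite mul1r.
    by apply=> //; rewrite exprn_gt0.
  - apply: qh_dist_connected => // u v Gu Gv.
    by apply: le_lt_trans (bound u v Gu Gv) _; rewrite ltry.
have partII psi : uniform_domain psi G ->
    uniform_domain (fun t => 3 * psi (2 ^+ 7 * t)) D.
  move=> unifG; have [hom _ _ unif] := unifG; split=> //.
    by apply: half_line_homeo_scale => //; rewrite exprn_gt0.
  move=> u v Du Dv; apply: (qh_dist_D_le dimE oD DT cC PE sepP) => // t t0.
  exact: uniform_domain_ln unifG t0.
split; last 2 first.
- by move=> psi _; exact: partI.
- by move=> psi _; exact: partII.
split=> -[psi unif].
  by exists (fun t => 2 ^+ 12 * psi t); exact: partI.
by exists (fun t => 3 * psi (2 ^+ 7 * t)); exact: partII.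
Qed.
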